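(* Let $E$ be a Banach space with a normalized 1-unconditional basis $(e_j)$, let $(X_j)$ be a sequence of Banach spaces and $Z$ a Banach space. Let $E$ be $q$-concave for some $q$, $1\le q\le\infty$, let $S\in B\big(Z,(\sum_{j=1}^\infty X_j)_E\big)$, and denote by $P_n:(\sum_{j=1}^\infty X_j)_E\to X_n$ the canonical projection for all $n\in\mathbb N$. If $\sum_{n=1}^\infty i_q(P_nS)e_n$ converges in $E$ (in particular each $P_nS$ is $q$-integral), then $S$ is $q$-integral and $$i_q(S)\le K_q(E)\,\Big\|\sum_{n=1}^\infty i_q(P_nS)e_n\Big\|_E.$$
   Context: $B(Z,Y)$ is the space of bounded linear operators. $(\sum_{n=1}^\infty X_n)_E$ is the Banach space of all $x\in\prod_n X_n$ such that $\sum_n\|x(n)\|e_n$ converges in $E$, with norm $\|x\|=\|\sum_n\|x(n)\|e_n\|_E$; $P_nx=x(n)$. For $1\le q<\infty$, an operator $T:Z\to Y$ is $q$-integral if $T=BjA$ with $A:Z\to L_\infty(\mu)$, $B:L_q(\mu)\to Y$ bounded, $\mu$ a probability measure and $j:L_\infty(\mu)\to L_q(\mu)$ the formal inclusion (the factorization ends in $Y$, not in $Y^{**}$), and $i_q(T)=\inf\|A\|\|B\|$ over all such factorizations. For $q=\infty$, ''$\infty$-integral'' means factoring through some $L_\infty(\mu)$ and $i_\infty(T)=\gamma_\infty(T)=\inf\{\|A\|\|B\|: T=BA,\ A\in B(Z,L_\infty(\mu)),\ B\in B(L_\infty(\mu),Y)\}$ over all measures $\mu$. $E$ is a Banach lattice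 under the order given coordinatewise by $(e_j)$. It is $q$-concave if there is $K$ with $(\sum_i\|x_i\|^q)^{1/q}\le K\|(\sum_i|x_i|^q)^{1/q}\|$ for all finite families in $E$ (sums replaced by maxima/suprema if $q=\infty$); the smallest such $K$ is $K_q(E)$. *)

(* Defs.v *)
From HB Require Import structures.
From mathcomp Require Import all_boot all_order all_algebra.
From mathcomp Require Import all_classical all_reals.
From mathcomp Require Import ereal topology normedtype sequences exp measure.
From mathcomp Require Import ess_sup_inf measurable_realfun lebesgue_measure.
From mathcomp Require Import lebesgue_integral hoelder.
From mathcomp Require Import lra.
Set Implicit Arguments. Unset Strict Implicit. Unset Printing Implicit Defensive.
Import Order.TTheory GRing.Theory Num.Theory.
Import numFieldNormedType.Exports.
Local Open Scope classical_set_scope.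
Local Open Scope ring_scope.

(* All Banach spaces are over the reals. *)

(* [LspaceType mu p1] is the library's space L_p(mu) of classes of p-integrable
   functions modulo a.e. equality, for an arbitrary measure mu and p : \bar R
   with p1 : 1 <= p; we equip it with its structure of normed space. *)
Section LspaceZmod.
Context d (T : measurableType d) (R : realType) (mu : {measure set T -> \bar R}).
Variables (p : \bar R) (p1 : (1 <= p)%E).
Local Notation L := (LspaceType mu p1).
Local Open Scope quotient_scope.

Lemma Lnorm_ae_eq (f g : T -> R) :
  measurable_fun setT f -> measurable_fun setT g ->
  f = g %[ae mu] -> ('N[mu]_p[EFin \o f] = 'N[mu]_p[EFin \o g])%E.
Proof.
have mN (h : T -> R) r : measurable_fun setT h ->
    measurable_fun setT (fun x => `|(EFin \o h) x| `^ r)%E.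
  move=> mh; apply: (@measurableT_comp _ _ _ _ _ _ (fun x : \bar R => x `^ r)%E).
    exact: measurable_poweR.
  by apply: measurableT_comp => //; exact/measurable_EFinP.
move=> mf mg fg; rewrite unlock /Lnorm.
move: p p1; case=> [r r1|_|//].
  apply: (congr1 (fun z => poweR z _)); apply: ae_eq_integral; [by []|exact: mN|exact: mN|].
  by apply: filterS fg => x /(_ I) fgx _ /=; rewrite fgx.
case: ifP => [_|//]; apply: eq_ess_sup => /=.
by apply: filterS fg => x /(_ I) /= ->.
Qed.

Lemma Lspace_measurable (f : L) : measurable_fun setT (f : T -> R).
Proof. exact: (@measurable_funPT _ _ _ _ (repr (LebesgueSpace.sort f))). Qed.

Lemma Lspace_repr_Lfun (f : L) : (f : T -> R) \in Lfun mu p.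
Proof.
apply/andP; split; rewrite inE /=; last exact: (@Lebesgue_finite _ _ _ _ _ p1 f).
exact: Lspace_measurable.
Qed.

Definition Lspace_repr (f : L) : LfunType mu p1 :=
  Lfun_Sub p1 (Lspace_repr_Lfun f).

(* [LfunType] and [LspaceType] see the measurable structure of R through two
   different displays, so that elements of the former must be repackaged. *)
Lemma Lfun_measurable (f : LfunType mu p1) :
  measurable_fun setT (f : T -> measurableTypeR R).
Proof. exact: (@measurable_funPT _ _ _ _ (f : {mfun T >-> R})). Qed.

Definition Lfun_mfun (f : LfunType mu p1) : {mfun T >-> measurableTypeR R} :=
  HB.pack (f : T -> measurableTypeR R)
    (isMeasurableFun.Build _ _ _ _ (f : T -> measurableTypeR R) (Lfun_measurable f)).

Definition Lfun_class (f : LfunType mu p1) : {mfun_ mu, T >-> measurableTypeR R} :=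
  \pi_{mfun_ mu, T >-> measurableTypeR R} (Lfun_mfun f).

Lemma Lfun_class_ae (f : LfunType mu p1) : (Lfun_class f : T -> R) = f %[ae mu].
Proof.
have : \pi_{mfun_ mu, T >-> measurableTypeR R} (repr (Lfun_class f)) = Lfun_class f.
  exact: reprK.
by move=> /eqmodP/asboolP.
Qed.

Lemma Lfun_class_finite (f : LfunType mu p1) : finite_norm mu p (Lfun_class f).
Proof.
rewrite /finite_norm.
rewrite (@Lnorm_ae_eq _ f) //; last exact: Lfun_class_ae.
  exact: (@Lfunction_finite _ _ _ _ _ _ f).
exact: (@measurable_funPT _ _ _ _ (repr (Lfun_class f))).
Qed.
HB.instance Definition _ f := isFinLebesgue.Build d T R mu p p1 (Lfun_class f) (Lfun_class_finite f).

Definition Lspace_class (f : LfunType mu p1) : L := Lfun_class f.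

Lemma Lspace_inj (f g : L) : LebesgueSpace.sort f = LebesgueSpace.sort g -> f = g.
Proof.
case: f g => [f [[fP]]] [g [[gP]]] /= fg; move: fP gP; rewrite fg => fP gP.
by rewrite (bool_irrelevance fP gP).
Qed.

Lemma Lspace_reprK : cancel Lspace_repr Lspace_class.
Proof.
move=> f; apply: Lspace_inj => /=.
rewrite -[RHS](reprK (LebesgueSpace.sort f)) /Lfun_class.
by congr \pi; apply/val_inj.
Qed.

Lemma Lspace_classP (f g : LfunType mu p1) :
  Lspace_class f = Lspace_class g <-> f = g %[ae mu].
Proof.
split=> [fg|fg].
  by have /eqmodP/asboolP := congr1 (@LebesgueSpace.sort _ _ _ _ _ _) fg.
by apply: Lspace_inj; apply/eqmodP/asboolP.
Qed.

Lemma Lspace_class_repr (f : LfunType mu p1) :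
  Lspace_repr (Lspace_class f) = f %[ae mu].
Proof. by apply/Lspace_classP; rewrite Lspace_reprK. Qed.

HB.instance Definition _ := gen_eqMixin L.
HB.instance Definition _ := gen_choiceMixin L.

Definition Lspace_zero : L := Lspace_class 0.
Definition Lspace_opp (f : L) : L := Lspace_class (- Lspace_repr f).
Definition Lspace_add (f g : L) : L :=
  Lspace_class (Lspace_repr f + Lspace_repr g).
Definition Lspace_scale (a : R) (f : L) : L :=
  Lspace_class (a *: Lspace_repr f).

Lemma Lspace_class_congr1 (h : R -> R) (f g u v : LfunType mu p1) :
  (forall x, u x = h (f x)) -> (forall x, v x = h (g x)) ->
  f = g %[ae mu] -> Lspace_class u = Lspace_class v.
Proof.
move=> uh vh fg; apply/Lspace_classP; apply: filterS fg => x /(_ I) fg _.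
by rewrite uh vh fg.
Qed.

Lemma Lspace_class_congr2 (h : R -> R -> R) (f g f' g' u v : LfunType mu p1) :
  (forall x, u x = h (f x) (f' x)) -> (forall x, v x = h (g x) (g' x)) ->
  f = g %[ae mu] -> f' = g' %[ae mu] -> Lspace_class u = Lspace_class v.
Proof.
move=> uh vh fg fg'; apply/Lspace_classP.
apply: filterS2 fg fg' => x /(_ I) fg /(_ I) fg' _.
by rewrite uh vh fg fg'.
Qed.

Lemma Lspace_class_add f g :
  Lspace_add (Lspace_class f) (Lspace_class g) = Lspace_class (f + g).
Proof.
by apply: (Lspace_class_congr2 (h := +%R) (f := Lspace_repr (Lspace_class f))
  (f' := Lspace_repr (Lspace_class g)) (g := f) (g' := g)) => //;
  exact: Lspace_class_repr.
Qed.

Lemma Lspace_class_opp f :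
  Lspace_opp (Lspace_class f) = Lspace_class (- f).
Proof.
by apply: (Lspace_class_congr1 (h := -%R) (f := Lspace_repr (Lspace_class f))
  (g := f)) => //; exact: Lspace_class_repr.
Qed.

Lemma Lspace_class_scale a f :
  Lspace_scale a (Lspace_class f) = Lspace_class (a *: f).
Proof.
by apply: (Lspace_class_congr1 (h := *%R a) (f := Lspace_repr (Lspace_class f))
  (g := f)) => //; exact: Lspace_class_repr.
Qed.

Lemma Lspace_ind (P : L -> Prop) : (forall f, P (Lspace_class f)) -> forall f, P f.
Proof. by move=> Pc f; rewrite -(Lspace_reprK f). Qed.

Lemma Lspace_addA : associative Lspace_add.
Proof.
by elim/Lspace_ind=> f; elim/Lspace_ind=> g; elim/Lspace_ind=> h;
  rewrite !Lspace_class_add addrA.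
Qed.

Lemma Lspace_addC : commutative Lspace_add.
Proof. by move=> f g; rewrite /Lspace_add addrC. Qed.

Lemma Lspace_add0 : left_id Lspace_zero Lspace_add.
Proof. by elim/Lspace_ind=> f; rewrite Lspace_class_add add0r. Qed.

Lemma Lspace_addN : left_inverse Lspace_zero Lspace_opp Lspace_add.
Proof.
by elim/Lspace_ind=> f; rewrite Lspace_class_opp Lspace_class_add addNr.
Qed.

HB.instance Definition _ := GRing.isZmodule.Build L
  Lspace_addA Lspace_addC Lspace_add0 Lspace_addN.

Lemma Lspace_scaleA a b (f : L) :
  Lspace_scale a (Lspace_scale b f) = Lspace_scale (a * b) f.
Proof. by elim/Lspace_ind: f => f; rewrite !Lspace_class_scale scalerA. Qed.

Lemma Lspace_scale1 : left_id 1 Lspace_scale.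
Proof. by elim/Lspace_ind=> f; rewrite Lspace_class_scale scale1r. Qed.

Lemma Lspace_scaleDr : right_distributive Lspace_scale +%R.
Proof.
move=> a; elim/Lspace_ind=> f; elim/Lspace_ind=> g.
by rewrite [_ + _]Lspace_class_add !Lspace_class_scale scalerDr -Lspace_class_add.
Qed.

Lemma Lspace_scaleDl (f : L) :
  {morph Lspace_scale^~ f : a b / a + b}.
Proof.
move=> a b; elim/Lspace_ind: f => f.
by rewrite !Lspace_class_scale scalerDl -Lspace_class_add.
Qed.

HB.instance Definition _ := GRing.Zmodule_isLmodule.Build R L
  Lspace_scaleA Lspace_scale1 Lspace_scaleDr Lspace_scaleDl.

Definition Lspace_norm (f : L) : R := fine ('N[mu]_p[EFin \o f])%E.

Lemma Lspace_norm_class (f : LfunType mu p1) :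
  Lspace_norm (Lspace_class f) = fine ('N[mu]_p[EFin \o f])%E.
Proof.
congr fine; apply: Lnorm_ae_eq; [exact: Lspace_measurable| |].
  exact: Lfun_measurable.
exact: Lfun_class_ae.
Qed.

Lemma Lspace_normD (f g : L) :
  Lspace_norm (f + g) <= Lspace_norm f + Lspace_norm g.
Proof.
elim/Lspace_ind: f => f; elim/Lspace_ind: g => g.
rewrite [_ + _]Lspace_class_add !Lspace_norm_class; exact: ler_LnormD.
Qed.

Lemma Lspace_normZ a (f : L) : Lspace_norm (a *: f) = `|a| * Lspace_norm f.
Proof.
elim/Lspace_ind: f => f.
rewrite [_ *: _]Lspace_class_scale !Lspace_norm_class.
by apply: EFin_inj; rewrite EFinM !finite_norm_fine; exact: LnormZ.
Qed.

Lemma Lspace_norm_eq0 (f : L) : Lspace_norm f = 0 -> f = 0.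
Proof.
elim/Lspace_ind: f => f; rewrite Lspace_norm_class => /fine_Lnormr_eq0 f0.
exact/Lspace_classP.
Qed.

HB.instance Definition _ := Lmodule_isNormed.Build R L
  Lspace_normD Lspace_normZ Lspace_norm_eq0.

Lemma Lspace_normE (f : L) : `|f| = fine ('N[mu]_p[EFin \o f])%E.
Proof. by []. Qed.

End LspaceZmod.

Section Lspace_inclusion.
Context d (T : measurableType d) (R : realType) (P : probability T R).
Variables (q : \bar R) (q1 : (1 <= q)%E).

Lemma Linfty_Lfun (f : LspaceType P (leey 1%E)) : (f : T -> R) \in Lfun P q.
Proof.
apply: (@Lfun_subset _ _ _ P q +oo%E q1 (leey _)); last exact: Lspace_repr_Lfun.
  exact: fin_num_measure.
exact: leey.
Qed.

(* The formal inclusion of L_oo(P) in L_q(P); by [Linfty_incl_sort] it does not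
   change the class of functions. *)
Definition Linfty_incl (f : LspaceType P (leey 1%E)) : LspaceType P q1 :=
  Lspace_class (Lfun_Sub q1 (Linfty_Lfun f)).

Lemma Linfty_incl_sort (f : LspaceType P (leey 1%E)) :
  LebesgueSpace.sort (Linfty_incl f) = LebesgueSpace.sort f.
Proof.
rewrite -[RHS](reprK (LebesgueSpace.sort f)) /= /Lfun_class.
by congr (\pi)%qT; apply/val_inj.
Qed.

End Lspace_inclusion.

Section bases.
Context (R : realType) (E : completeNormedModType R).

Definition schauder_basis (e : nat -> E) : Prop :=
  forall x : E, exists! a : nat -> R, series (fun j => a j *: e j) @ \oo --> x.

(* The unconditional basis constant is 1: changing the signs of the
   coefficients of a finite linear combination does not increase its norm. *)
Definition one_unconditional (e : nat -> E) : Prop :=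
  forall (a : nat -> R) (s : nat -> bool) (n : nat),
    `|\sum_(j < n) ((-1) ^+ s j * a j) *: e j| <= `|\sum_(j < n) a j *: e j|.

Record normalized_unconditional1_basis (e : nat -> E) : Prop := {
  basis_schauder : schauder_basis e ;
  basis_normalized : forall j, `|e j| = 1 ;
  basis_unconditional : one_unconditional e }.

Section basis_theory.
Context (e : nat -> E) (he : normalized_unconditional1_basis e).

Lemma unconditional_contract n (b t : nat -> R) : (forall j, `|t j| <= 1) ->
  `|\sum_(j < n) (t j * b j) *: e j| <= `|\sum_(j < n) b j *: e j|.
Proof.
move=> t1.
suff H k u : (forall j, `|u j| <= 1) ->
    (forall j, (k <= j)%N -> exists s : bool, u j = (-1) ^+ s) ->
    `|\sum_(j < n) (u j * b j) *: e j| <= `|\sum_(j < n) b j *: e j|.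
  pose u j := if (j < n)%N then t j else 1.
  have -> : \sum_(j < n) (t j * b j) *: e j = \sum_(j < n) (u j * b j) *: e j.
    by apply: eq_bigr => j _; rewrite /u ltn_ord.
  apply: (H n) => [j|j nj]; rewrite /u; first by case: ifP => // _; rewrite normr1.
  by rewrite ltnNge nj /=; exists false.
elim: k u => [|k IH] u u1 us.
  have {}us j : exists s : bool, u j = (-1) ^+ s by exact: us.
  have [s sE] := choice us.
  under eq_bigr do rewrite sE.
  exact: basis_unconditional.
pose v (c : R) j := if j == k then c else u j.
have vs (s : bool) : `|\sum_(j < n) (v ((-1) ^+ s) j * b j) *: e j| <=
    `|\sum_(j < n) b j *: e j|.
  apply: IH => j; rewrite /v; case: eqP => // jk.
  - by rewrite normrX normrN1 expr1n.
  - by exists s.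
  - move=> kj; apply: us; rewrite ltn_neqAle kj andbT.
    by apply/eqP => kj'; apply: jk.
pose l := (1 + u k) / 2.
have uk : (-1 <= u k) && (u k <= 1) by rewrite -ler_norml u1.
have l0 : 0 <= l by rewrite /l; case/andP: uk => ? ?; rewrite divr_ge0// -lerBlDl sub0r.
have l1 : 0 <= 1 - l.
  by rewrite subr_ge0 /l ler_pdivrMr// mul1r; case/andP: uk => ? ?; rewrite -[2]/(1+1) lerD2l.
have -> : \sum_(j < n) (u j * b j) *: e j =
    l *: (\sum_(j < n) (v ((-1) ^+ false) j * b j) *: e j) +
    (1 - l) *: (\sum_(j < n) (v ((-1) ^+ true) j * b j) *: e j).
  rewrite !scaler_sumr -big_split/=; apply: eq_bigr => j _.
  rewrite !scalerA -scalerDl; congr (_ *: _).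
  rewrite !mulrA -mulrDl; congr (_ * _).
  rewrite /v; case: eqP => [->|_]; last by rewrite -mulrDl subrKC mul1r.
  by rewrite expr0 expr1 /l; lra.
have nZ (c : R) (x : E) : 0 <= c -> `|c *: x| = c * `|x|.
  by move=> c0; rewrite normrZ ger0_norm.
rewrite (le_trans (ler_normD _ _))// (nZ _ _ l0) (nZ _ _ l1).
rewrite (le_trans (lerD (ler_wpM2l l0 (vs false)) (ler_wpM2l l1 (vs true))))//.
by rewrite -mulrDl subrKC mul1r.
Qed.

Lemma unconditional_le m n (a b : nat -> R) : (forall j, `|a j| <= `|b j|) ->
  `|\sum_(m <= j < n) a j *: e j| <= `|\sum_(m <= j < n) b j *: e j|.
Proof.
move=> ab.
pose b' j := if (m <= j)%N then b j else 0.
have sumE (c : nat -> R) : \sum_(m <= j < n) c j *: e j =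
    \sum_(j < n) (if (m <= j)%N then c j else 0) *: e j.
  have [mn|nm] := leqP m n; last first.
    rewrite big_geq 1?ltnW// big1// => j _.
    by rewrite leqNgt (ltn_trans (ltn_ord j) nm)/= scale0r.
  rewrite -(big_mkord xpredT (fun j => (if (m <= j)%N then c j else 0) *: e j)).
  have -> : \sum_(0 <= j < n) (if (m <= j)%N then c j else 0) *: e j =
      \sum_(0 <= j < m) (if (m <= j)%N then c j else 0) *: e j +
      \sum_(m <= j < n) (if (m <= j)%N then c j else 0) *: e j.
    by rewrite -big_cat_nat.
  have -> : \sum_(0 <= j < m) (if (m <= j)%N then c j else 0) *: e j = 0.
    rewrite big_nat; apply: big1 => j /andP[_ jm].
    by rewrite leqNgt jm/= scale0r.
  by rewrite add0r; apply: eq_big_nat => j /andP[-> _].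
rewrite !sumE -/b'.
pose t j := a j / b j.
have t1 j : `|t j| <= 1.
  rewrite /t normrM normfV; have [b0|b0] := eqVneq (b j) 0.
    by rewrite b0 normr0 invr0 mulr0.
  by rewrite ler_pdivrMr ?normr_gt0// mul1r.
rewrite (le_trans _ (unconditional_contract n b' t1))//.
rewrite le_eqVlt; apply/orP; left; apply/eqP; congr (`| _ |).
apply: eq_bigr => j _; congr (_ *: _); rewrite /b' /t.
case: ifP => _; last by rewrite mulr0.
have [b0|b0] := eqVneq (b j) 0; last by rewrite mulfVK.
by have := ab j; rewrite b0 normr0 normr_le0 mulr0 => /eqP.
Qed.

Lemma unconditional_cvg (a b : nat -> R) : (forall j, `|a j| <= `|b j|) ->
  cvgn (series (fun j => b j *: e j)) -> cvgn (series (fun j => a j *: e j)).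
Proof.
move=> ab /cauchy_cvgP/cauchy_seriesP bcvg; apply/cauchy_cvgP/cauchy_seriesP.
move=> eps /bcvg; apply: filterS => n; apply: le_lt_trans.
exact: unconditional_le.
Qed.

Lemma unconditional_lim_le (a b : nat -> R) : (forall j, `|a j| <= `|b j|) ->
  cvgn (series (fun j => b j *: e j)) ->
  `|limn (series (fun j => a j *: e j))| <= `|limn (series (fun j => b j *: e j))|.
Proof.
move=> ab cb; have ca := unconditional_cvg ab cb.
apply: (ler_cvg_to (cvg_norm ca) (cvg_norm cb)).
by apply: nearW => n; exact: unconditional_le.
Qed.

Lemma basis_unique (a b : nat -> R) (x : E) :
  series (fun j => a j *: e j) @ \oo --> x ->
  series (fun j => b j *: e j) @ \oo --> x -> a = b.
Proof. by move=> ax bx; have [c [_ cu]] := basis_schauder he x; rewrite -(cu a)// (cu b). Qed.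

Definition coord (x : E) : nat -> R := sval (cid (basis_schauder he x)).

Lemma coord_cvg x : series (fun j => coord x j *: e j) @ \oo --> x.
Proof. by rewrite /coord; case: cid => a []. Qed.

End basis_theory.
End bases.

Section lq.
Context (R : realType).

(* The l_q norm of a finite family; -oo is a junk case, q >= 1 everywhere. *)
Definition lq_norm (q : \bar R) (m : nat) (s : 'I_m -> R) : R :=
  match q with
  | r%:E => (\sum_i `|s i| `^ r) `^ r^-1
  | +oo%E => \big[Num.max/0]_i `|s i|
  | -oo%E => 0
  end.

Lemma lq_norm_ge0 q m (s : 'I_m -> R) : 0 <= lq_norm q s.
Proof.
case: q => [r||] //=; first exact: powR_ge0.
by elim/big_ind: _ => // x y x0 y0; rewrite le_max x0.
Qed.

Lemma lq_norm_le q m : (1 <= q)%E -> exists2 C : R, 0 <= C &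
  forall s : 'I_m -> R, lq_norm q s <= C * \sum_i `|s i|.
Proof.
have le_sum (s : 'I_m -> R) i : `|s i| <= \sum_i `|s i|.
  by rewrite (bigD1 i)//= lerDl sumr_ge0.
case: q => [r||] //=; last first.
  move=> _; exists 1 => // s; rewrite mul1r.
  elim/big_ind: _ => // [|x y x0 y0]; first by rewrite sumr_ge0.
  by rewrite ge_max x0.
rewrite lee_fin => r1; have r0 : 0 < r by rewrite (lt_le_trans ltr01).
exists (m%:R `^ r^-1) => [|s]; first exact: powR_ge0.
have S0 : 0 <= \sum_i `|s i| by rewrite sumr_ge0.
rewrite /= -[X in _ <= _ * X]powRr1// -[X in _ <= _ * _ `^ X](mulfV (lt0r_neq0 r0)).
rewrite powRrM -powRM ?ler0n ?powR_ge0//.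
apply: ge0_ler_powR; rewrite ?nnegrE ?invr_ge0 ?(ltW r0)//.
- by rewrite sumr_ge0// => i _; exact: powR_ge0.
- by rewrite mulr_ge0 ?ler0n ?powR_ge0.
have -> : m%:R * (\sum_i `|s i|) `^ r = \sum_(i < m) (\sum_i `|s i|) `^ r.
  by rewrite sumr_const card_ord mulr_natl.
apply: ler_sum => i _.
by apply: ge0_ler_powR; rewrite ?nnegrE ?(ltW r0).
Qed.

End lq.

Section series_module.
Context (R : realType) (E : completeNormedModType R) (e : nat -> E).

Lemma coef_seriesD (a b : nat -> R) :
  cvgn (series (fun j => a j *: e j)) -> cvgn (series (fun j => b j *: e j)) ->
  series (fun j => (a j + b j) *: e j) @ \oo -->
    limn (series (fun j => a j *: e j)) + limn (series (fun j => b j *: e j)).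
Proof.
move=> ca cb.
have -> : series (fun j => (a j + b j) *: e j) =
    series (fun j => a j *: e j) + series (fun j => b j *: e j).
  by rewrite -seriesD; congr series; apply/funext => j; rewrite scalerDl.
exact: cvgD.
Qed.

Lemma coef_seriesZ (c : R) (a : nat -> R) : cvgn (series (fun j => a j *: e j)) ->
  series (fun j => (c * a j) *: e j) @ \oo -->
    c *: limn (series (fun j => a j *: e j)).
Proof.
move=> ca.
have -> : series (fun j => (c * a j) *: e j) = c *: series (fun j => a j *: e j).
  by rewrite -seriesZ; congr series; apply/funext => j; rewrite /= [in RHS]/GRing.scale/= scalerA.
exact: cvgZr.
Qed.

End series_module.

Section concavity.
Context (R : realType) (E : completeNormedModType R) (e : nat -> E).
Context (he : normalized_unconditional1_basis e).

(* The element (\sum_i |x_i|^q)^(1/q) (sup_i |x_i| if q = +oo) of the Banach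
   lattice E: as the order is coordinatewise, it is computed coordinatewise.
   The series converges by [lattice_lq_cvg]. *)
Definition lattice_lq (q : \bar R) (m : nat) (x : 'I_m -> E) : E :=
  limn (series (fun j => lq_norm q (fun i => coord he (x i) j) *: e j)).

Lemma lattice_lq_cvg q m (x : 'I_m -> E) : (1 <= q)%E ->
  series (fun j => lq_norm q (fun i => coord he (x i) j) *: e j) @ \oo -->
    lattice_lq q x.
Proof.
move=> q1; have [C C0 CP] := lq_norm_le m q1.
apply: (unconditional_cvg he (b := fun j => C * \sum_i `|coord he (x i) j|)) => [j|].
  by rewrite !ger0_norm ?lq_norm_ge0// ?mulr_ge0 ?sumr_ge0.
suff c : cvgn (series (fun j => (\sum_i `|coord he (x i) j|) *: e j)).
  by apply: cvgP; exact: coef_seriesZ.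
elim: (index_enum 'I_m) => [|i s IH].
  apply: (unconditional_cvg he (b := coord he 0)) => [j|].
    by rewrite big_nil normr0.
  by apply: cvgP; exact: coord_cvg.
have ci : cvgn (series (fun j => `|coord he (x i) j| *: e j)).
  apply: (unconditional_cvg he (b := coord he (x i))) => [j|].
    by rewrite normr_id.
  by apply: cvgP; exact: coord_cvg.
under eq_fun do rewrite big_cons.
by apply: cvgP; exact: coef_seriesD.
Qed.

Definition q_concave_with (q : \bar R) (K : R) : Prop :=
  forall (m : nat) (x : 'I_m -> E),
    lq_norm q (fun i => `|x i|) <= K * `|lattice_lq q x|.

Definition q_concave (q : \bar R) : Prop := exists K, q_concave_with q K.

(* K_q(E); the infimum is a minimum by [concavity_constantP]. *)
Definition concavity_constant (q : \bar R) : R := inf [set K | q_concave_with q K].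

End concavity.

Section concavity_theory.
Context (R : realType) (E : completeNormedModType R) (e : nat -> E).
Context (he : normalized_unconditional1_basis e).

Lemma concavity_constantP (q : \bar R) : (1 <= q)%E -> q_concave he q ->
  q_concave_with he q (concavity_constant he q) /\
  forall K, q_concave_with he q K -> concavity_constant he q <= K.
Proof.
move=> q1 [K0 K0P].
have lb : has_lbound [set K | q_concave_with he q K].
  exists 0 => K /= /(_ 1%N (fun=> e 0%N)).
  have s0 : 0 < lq_norm q (fun _ : 'I_1 => `|e 0%N|).
    rewrite (basis_normalized he); case: q q1 {K0P} => [r||]//= _.
      by rewrite big_ord1 !normr1 !powR1.
    by rewrite big_ord_recl big_ord0 normr1 lt_max ltr01.
  move=> /(lt_le_trans s0); rewrite leNgt; apply: contraTN => K0'.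
  by rewrite -leNgt nmulr_rle0.
split=> [m x|K KP]; last exact: ge_inf.
have [N0|N0] := eqVneq `|lattice_lq he q x| 0.
  by have := K0P m x; rewrite N0 !mulr0.
have {}N0 : 0 < `|lattice_lq he q x| by rewrite lt0r N0/=.
rewrite -ler_pdivrMr//; apply: lb_le_inf; first by exists K0.
by move=> K KP; rewrite ler_pdivrMr//; exact: KP.
Qed.
End concavity_theory.

(* (\sum_n X_n)_E. The parameter [he] does not occur in the fields: it is there for the
   instances below, which depend on it. *)
Record dsum (R : realType) (E : completeNormedModType R) (e : nat -> E)
    (he : normalized_unconditional1_basis e)
    (X : nat -> completeNormedModType R) : Type := DSum {
  dsum_val :> forall n, X n ;
  dsum_cvg : cvgn (series (fun n => `|dsum_val n| *: e n)) }.
Arguments dsum_cvg {R E e he X}.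

Section direct_sum.
Context (R : realType) (E : completeNormedModType R) (e : nat -> E).
Context (he : normalized_unconditional1_basis e).
Context (X : nat -> completeNormedModType R).
Local Notation dsum := (dsum he X).

HB.instance Definition _ := gen_eqMixin dsum.
HB.instance Definition _ := gen_choiceMixin dsum.

Lemma dsumP (x y : dsum) : (forall n, x n = y n) -> x = y.
Proof.
case: x y => [x xc] [y yc] /= xy.
have {}xy : x = y by exact: functional_extensionality_dep.
by move: xc yc; rewrite xy => xc yc; rewrite (Prop_irrelevance xc yc).
Qed.

Lemma dsum_zero_cvg : cvgn (series (fun n => `|0 : X n| *: e n)).
Proof.
apply: (unconditional_cvg he (b := coord he 0)) => [j|].
  by rewrite normr0 normr0.
by apply: cvgP; exact: coord_cvg.
Qed.

Lemma dsum_opp_cvg (x : dsum) : cvgn (series (fun n => `|- x n| *: e n)).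
Proof. by under eq_fun do rewrite normrN; exact: dsum_cvg. Qed.

Lemma dsum_add_cvg (x y : dsum) : cvgn (series (fun n => `|x n + y n| *: e n)).
Proof.
apply: (unconditional_cvg he (b := fun n => `|x n| + `|y n|)) => [j|].
  by rewrite normr_id ger0_norm ?addr_ge0// ler_normD.
by apply: cvgP; apply: coef_seriesD; exact: dsum_cvg.
Qed.

Lemma dsum_scale_cvg (a : R) (x : dsum) :
  cvgn (series (fun n => `|a *: x n| *: e n)).
Proof.
under eq_fun do rewrite normrZ.
by apply: cvgP; apply: coef_seriesZ; exact: dsum_cvg.
Qed.

Definition dsum_zero : dsum := @DSum _ _ _ he X (fun=> 0) dsum_zero_cvg.
Definition dsum_opp (x : dsum) : dsum := DSum he (@dsum_opp_cvg x).
Definition dsum_add (x y : dsum) : dsum := DSum he (@dsum_add_cvg x y).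
Definition dsum_scale (a : R) (x : dsum) : dsum := DSum he (@dsum_scale_cvg a x).

Lemma dsum_addA : associative dsum_add.
Proof. by move=> x y z; apply: dsumP => n; exact: addrA. Qed.

Lemma dsum_addC : commutative dsum_add.
Proof. by move=> x y; apply: dsumP => n; exact: addrC. Qed.

Lemma dsum_add0 : left_id dsum_zero dsum_add.
Proof. by move=> x; apply: dsumP => n; exact: add0r. Qed.

Lemma dsum_addN : left_inverse dsum_zero dsum_opp dsum_add.
Proof. by move=> x; apply: dsumP => n; exact: addNr. Qed.

HB.instance Definition _ := GRing.isZmodule.Build dsum
  dsum_addA dsum_addC dsum_add0 dsum_addN.

Lemma dsum_scaleA a b x : dsum_scale a (dsum_scale b x) = dsum_scale (a * b) x.
Proof. by apply: dsumP => n; exact: scalerA. Qed.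

Lemma dsum_scale1 : left_id 1 dsum_scale.
Proof. by move=> x; apply: dsumP => n; exact: scale1r. Qed.

Lemma dsum_scaleDr : right_distributive dsum_scale +%R.
Proof. by move=> a x y; apply: dsumP => n; exact: scalerDr. Qed.

Lemma dsum_scaleDl x : {morph dsum_scale^~ x : a b / a + b}.
Proof. by move=> a b; apply: dsumP => n; exact: scalerDl. Qed.

HB.instance Definition _ := GRing.Zmodule_isLmodule.Build R dsum
  dsum_scaleA dsum_scale1 dsum_scaleDr dsum_scaleDl.

Definition dsum_norm (x : dsum) : R := `|limn (series (fun n => `|x n| *: e n))|.

Lemma dsum_normD x y : dsum_norm (x + y) <= dsum_norm x + dsum_norm y.
Proof.
have cD := coef_seriesD (dsum_cvg x) (dsum_cvg y).
apply: le_trans (ler_normD _ _); rewrite -(cvg_lim (@norm_hausdorff _ _) cD).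
apply: (unconditional_lim_le he) => [n|]; last exact: cvgP cD.
by rewrite normr_id [leRHS]ger0_norm ?addr_ge0// ler_normD.
Qed.

Lemma dsum_normZ a x : dsum_norm (a *: x) = `|a| * dsum_norm x.
Proof.
rewrite /dsum_norm; under eq_fun do rewrite [(_ *: x) _]/(a *: x _) normrZ.
rewrite (cvg_lim (@norm_hausdorff _ _) (@coef_seriesZ _ _ _ `|a| _ (dsum_cvg x))).
by rewrite normrZ normr_id.
Qed.

Lemma dsum_norm_eq0 x : dsum_norm x = 0 -> x = 0.
Proof.
move=> /eqP; rewrite normr_eq0 => /eqP x0.
have cx : series (fun n => `|x n| *: e n) @ \oo --> 0 by rewrite -x0; exact: dsum_cvg.
have c0 : series (fun n => (0 : R) *: e n) @ \oo --> (0 : E).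
  have -> : series (fun n => (0 : R) *: e n) = cst 0.
    by apply/funext => n; rewrite /series /= big1// => j _; rewrite scale0r.
  exact: cvg_cst.
apply: dsumP => n; apply/eqP; rewrite -normr_eq0; apply/eqP.
exact: (congr1 (fun f => f n) (basis_unique he cx c0)).
Qed.

HB.instance Definition _ := Lmodule_isNormed.Build R dsum
  dsum_normD dsum_normZ dsum_norm_eq0.

Lemma dsum_normE (x : dsum) : `|x| = `|limn (series (fun n => `|x n| *: e n))|.
Proof. by []. Qed.

Definition dsum_proj (n : nat) (x : dsum) : X n := x n.

Lemma dsum_proj_linear n : linear (dsum_proj n).
Proof. by []. Qed.

HB.instance Definition _ n := GRing.isLinear.Build R dsum (X n) *:%R
  (dsum_proj n) (dsum_proj_linear n).

End direct_sum.

Section operators.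
Context (R : realType).

Definition bounded_op (V W : normedModType R) (f : V -> W) : Prop :=
  exists M : R, forall x, `|f x| <= M * `|x|.

Definition opnorm (V W : normedModType R) (f : V -> W) : R :=
  sup [set `|f x| | x in [set x : V | `|x| <= 1]].

(* The products ||A|| ||B|| over all the factorizations T = B j A through the
   formal inclusion j of L_oo(mu) in L_q(mu), mu a probability measure. *)
Definition finite_integral_costs (q : \bar R) (q1 : (1 <= q)%E)
    (Z Y : normedModType R) (T : Z -> Y) : set R :=
  [set c | exists (d : measure_display) (Om : measurableType d)
      (mu : probability Om R)
      (A : {linear Z -> LspaceType mu (leey 1%E)})
      (B : {linear LspaceType mu q1 -> Y}),
    [/\ bounded_op A, bounded_op B,
        forall z, T z = B (Linfty_incl q1 (A z)) & c = opnorm A * opnorm B]].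

(* The products ||A|| ||B|| over all the factorizations T = B A through
   L_oo(mu), mu an arbitrary measure. *)
Definition infinite_integral_costs (Z Y : normedModType R) (T : Z -> Y) : set R :=
  [set c | exists (d : measure_display) (Om : measurableType d)
      (mu : {measure set Om -> \bar R})
      (A : {linear Z -> LspaceType mu (leey 1%E)})
      (B : {linear LspaceType mu (leey 1%E) -> Y}),
    [/\ bounded_op A, bounded_op B,
        forall z, T z = B (A z) & c = opnorm A * opnorm B]].

Definition integral_costs (q : \bar R) (q1 : (1 <= q)%E)
    (Z Y : normedModType R) (T : Z -> Y) : set R :=
  if q == +oo%E then infinite_integral_costs T else finite_integral_costs q1 T.

Definition q_integral (q : \bar R) (q1 : (1 <= q)%E)
    (Z Y : normedModType R) (T : Z -> Y) : Prop :=
  integral_costs q1 T !=set0.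

(* Meaningful only for [q_integral] operators: [inf set0] is a junk value. *)
Definition i_q (q : \bar R) (q1 : (1 <= q)%E)
    (Z Y : normedModType R) (T : Z -> Y) : R :=
  inf (integral_costs q1 T).

End operators.

(* Main.v *)
(* Put b_n slightly above i_q(P_n S), so that P_n S = B_n j A_n with |A_n| <= 1
   and |B_n| <= b_n.  For q < oo, q-concavity makes the diagonal operator
   s |-> \sum_n s_n b_n e_n q-summing on finitely supported sequences, with
   constant K_q(E) |\sum_n b_n e_n|; as in the domination theorem of Pietsch, for
   every C above this constant there is a probability (lam_n) on the integers with
   |\sum_n s_n b_n e_n|^q <= C^q \sum_n lam_n |s_n|^q.
   On the disjoint union of the probability spaces of the factorizations, weighted
   by (lam_n), the A_n glue to an operator A of norm at most 1 and
   f |-> (B_n f_n)_n is bounded by C, where f_n is the restriction of f.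
   For q = oo the weights play no role and are taken to be 1. *)

From HB Require Import structures.
Require Import Defs.
From mathcomp Require Import all_boot all_order all_algebra.
From mathcomp Require Import finmap interval_inference.
From mathcomp Require Import all_classical all_reals.
From mathcomp Require Import ereal topology normedtype sequences exp measure.
From mathcomp Require Import ess_sup_inf measurable_realfun lebesgue_measure.
From mathcomp Require Import lebesgue_integral hoelder.
From mathcomp Require Import ring lra.
Set Implicit Arguments. Unset Strict Implicit. Unset Printing Implicit Defensive.
Import Order.TTheory GRing.Theory Num.Theory.
Import numFieldNormedType.Exports.
Local Open Scope classical_set_scope.
Local Open Scope ring_scope.

(** * Domination by a probability on the integers *)

(** A valid [c] must be at least [g x / - f x] where [f x < 0] and at most [- g z / f z] where
    [0 < f z]. These bounds are compatible because the segment from [x] to [z] meets [f = 0], where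
    [g] is nonpositive. The supremum of the lower bounds, 0 included, therefore works. *)
Lemma affine_alternative (R : realType) (V : lmodType R) (L : set V)
    (f g : V -> R) :
  (forall x y t, 0 <= t <= 1 -> L x -> L y -> L (t *: x + (1 - t) *: y)) ->
  (forall x y t, 0 <= t <= 1 ->
    f (t *: x + (1 - t) *: y) = t * f x + (1 - t) * f y) ->
  (forall x y t, 0 <= t <= 1 ->
    g (t *: x + (1 - t) *: y) = t * g x + (1 - t) * g y) ->
  (exists2 x, L x & 0 < f x) ->
  (forall x, L x -> 0 <= f x -> g x <= 0) ->
  exists2 c, 0 <= c & forall x, L x -> g x + c * f x <= 0.
Proof.
move=> Lc fa ga [y Ly fy] gf.
pose A := [set c : R | c = 0 \/ exists2 x, L x /\ f x < 0 & c = g x / - f x].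
have ubA z : L z -> 0 < f z -> ubound A (- g z / f z).
  move=> Lz fz c [->|[x [Lx fx] ->]].
    by rewrite divr_ge0 ?(ltW fz)// oppr_ge0 gf// ltW.
  have d0 : 0 < f z - f x by lra.
  (* This is the parameter for which [f] vanishes at [t *: x + (1 - t) *: z]. *)
  pose t := f z / (f z - f x).
  have t01 : 0 <= t <= 1.
    rewrite /t divr_ge0 ?(ltW fz) ?(ltW d0)//= ler_pdivrMr// mul1r; lra.
  have tE : t * (f z - f x) = f z by rewrite /t divfK// gt_eqF.
  have fu : f (t *: x + (1 - t) *: z) = 0 by rewrite fa//; lra.
  have := gf _ (Lc _ _ _ t01 Lx Lz); rewrite fu ga// => /(_ (lexx _)) gu.
  rewrite ler_pdivlMr// mulrAC ler_pdivrMr ?oppr_gt0//.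
  have : (f z - f x) * (t * g x + (1 - t) * g z) <= 0.
    by rewrite pmulr_rle0.
  have -> : (f z - f x) * (t * g x + (1 - t) * g z) =
     (t * (f z - f x)) * g x + ((f z - f x) - t * (f z - f x)) * g z by ring.
  rewrite tE; lra.
have A0 : A !=set0 by exists 0; left.
have sA : has_sup A by split => //; exists (- g y / f y); exact: ubA.
have le_sup c : A c -> c <= sup A by exact: ub_le_sup sA.2 _.
exists (sup A); first by apply: le_sup; left.
move=> x Lx; have [fx|fx|fx] := ltgtP (f x) 0.
- have : g x / - f x <= sup A by apply: le_sup; right; exists x.
  by rewrite ler_pdivrMr ?oppr_gt0//; lra.
- have : sup A <= - g x / f x by apply: ge_sup => //; exact: ubA.
  by rewrite ler_pdivlMr//; lra.
- by rewrite fx mulr0 addr0 gf// fx.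
Qed.

(* Ville's theorem of the alternative, by induction on the number of functions:
   the last constraint is absorbed in the convex set. *)
Lemma convex_alternative (R : realType) (V : lmodType R) m (L : set V)
    (f : nat -> V -> R) :
  (forall x y t, 0 <= t <= 1 -> L x -> L y -> L (t *: x + (1 - t) *: y)) ->
  (forall i x y t, 0 <= t <= 1 ->
    f i (t *: x + (1 - t) *: y) = t * f i x + (1 - t) * f i y) ->
  L !=set0 ->
  (forall w : nat -> R, (forall i, 0 <= w i) ->
    (exists2 i, (i < m)%N & 0 < w i) ->
    exists2 x, L x & 0 < \sum_(i < m) w i * f i x) ->
  exists2 x, L x & forall i, (i < m)%N -> 0 <= f i x.
Proof.
move=> + fa; elim: m L => [|m IH] L Lc L0 H; first by case: L0 => x Lx; exists x.
(* Weights concentrated on the index [m] give this point. *)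
have [y Ly fy] : exists2 x, L x & 0 < f m x.
  have [||y Ly] := H (fun i => (i == m)%:R).
  - by move=> i; rewrite ler0n.
  - by exists m => //; rewrite eqxx.
  rewrite big_ord_recr/= eqxx mul1r big1 ?add0r; first by exists y.
  by move=> i _; rewrite (ltn_eqF (ltn_ord i)) mul0r.
have [|||x [Lx fx] fix_] := IH (L `&` [set x | 0 <= f m x]).
- move=> x z t /[dup] t01 /andP[t0 t1] [Lx fx] [Lz fz]; split; first exact: Lc.
  by rewrite /= fa// addr_ge0// mulr_ge0// subr_ge0.
- by exists y; split => //=; exact: ltW.
- move=> w w0 wm; apply: contrapT => nex.
  have gf x : L x -> 0 <= f m x -> \sum_(i < m) w i * f i x <= 0.
    by move=> Lx fx; rewrite leNgt; apply/negP => g0; apply: nex; exists x.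
  (* The multiplier [c] extends [w] to index [m] and yields weights whose combination is nonpositive
     on all of [L], contradicting [H]. *)
  have [|||c c0 cP] := affine_alternative Lc _ _ _ gf.
  + by move=> *; exact: fa.
  + move=> x z t t01; rewrite !mulr_sumr -big_split/=; apply: eq_bigr => i _.
    by rewrite fa//; ring.
  + by exists y.
  have [||x Lx] := H (fun i => if i == m then c else w i).
  + by move=> i; case: ifP.
  + have [i im wi] := wm; exists i; first exact: ltnW.
    by rewrite (ltn_eqF im).
  rewrite big_ord_recr/= eqxx.
  under eq_bigr => i _ do rewrite (ltn_eqF (ltn_ord i)).
  by rewrite ltNge cP.
exists x => // i; rewrite ltnS leq_eqVlt => /predU1P[->//|]; exact: fix_.
Qed.

Section subprob.
Context (R : realType).

(* Total mass at most 1 rather than equal to 1: this makes the set compact for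
   pointwise convergence. *)
Definition subprobs : set (nat -> R) :=
  [set l : nat -> R | (forall n, 0 <= l n) /\ forall N, \sum_(n < N) l n <= 1].

Lemma weighted_sum_continuous N (c : nat -> R) :
  continuous (fun l : {ptws nat -> R} => \sum_(n < N) l n * c n).
Proof.
have pc n : continuous (fun l : {ptws nat -> R} => l n).
  exact: (@proj_continuous nat (fun=> R^o) n).
elim: N => [|N IH].
  rewrite (_ : (fun _ => _) = cst 0); first exact: cst_continuous.
  by apply/funext => l; rewrite big_ord0.
pose g (l : {ptws nat -> R}) := \sum_(n < N) l n * c n.
pose h (l : {ptws nat -> R}) := l N * c N.
rewrite (_ : (fun _ => _) = (fun l => g l + h l)); last first.
  by apply/funext => l; rewrite big_ord_recr.
have hc : continuous h.
  move=> l; exact: (cvgM (pc N l) (cvg_cst (c N))).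
move=> l; exact: (cvgD (IH l) (hc l)).
Qed.

(** A closed subset of the cube of sequences in [[0, 1]], compact by Tychonoff: each bound on a
    partial sum involves finitely many coordinates, hence is a closed condition. *)
Lemma subprobs_compact : compact (subprobs : set {ptws nat -> R}).
Proof.
pose K : set {ptws nat -> R} := [set l | forall n, `[0, 1]%classic (l n)].
have Kc : compact K.
  exact: (@tychonoff nat (fun=> R^o) (fun=> `[0, 1]%classic)
    (fun=> @segment_compact R 0 1)).
have -> : (subprobs : set {ptws nat -> R}) =
    K `&` \bigcap_N [set l : {ptws nat -> R} | \sum_(n < N) l n <= 1].
  apply/seteqP; split=> [l [l0 l1]|l [Kl l1]].
    split=> [n /=|N _ /=]; last exact: l1.
    rewrite in_itv/= l0/= (le_trans _ (l1 n.+1))// big_ord_recr/= lerDr.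
    by rewrite sumr_ge0.
  split=> [n|N]; last exact: l1.
  by have := Kl n; rewrite /= in_itv/= => /andP[].
apply: compact_closedI => //; apply: closed_bigI => N _.
have sE (l : {ptws nat -> R}) : \sum_(n < N) l n * 1 = \sum_(n < N) l n.
  by apply: eq_bigr => n _; rewrite mulr1.
rewrite [X in closed X](_ : _ =
  (fun l : {ptws nat -> R} => \sum_(n < N) l n * 1) @^-1` [set x | x <= 1]).
  apply: preimage_closed; last exact: closed_le.
  by move=> ? _; exact: (@weighted_sum_continuous N (fun=> 1)).
by apply/seteqP; split=> l /=; rewrite sE.
Qed.

Lemma subprobs_convex (x y : nat -> R) (t : R) : 0 <= t <= 1 ->
  subprobs x -> subprobs y -> subprobs (t *: x + (1 - t) *: y).
Proof.
move=> /andP[t0 t1] [x0 x1] [y0 y1]; have t1' : 0 <= 1 - t by rewrite subr_ge0.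
have E n : (t *: x + (1 - t) *: y) n = t * x n + (1 - t) * y n by [].
split=> [n|N]; first by rewrite E addr_ge0// mulr_ge0.
under eq_bigr do rewrite E.
rewrite big_split/= -!mulr_sumr.
have := ler_wpM2l t0 (x1 N); have := ler_wpM2l t1' (y1 N); lra.
Qed.

Lemma subprobs_delta k : subprobs (fun n => (n == k)%:R).
Proof.
split=> [n|N]; first exact: ler0n.
have [kN|Nk] := ltnP k N.
  rewrite (bigD1 (Ordinal kN))//= eqxx big1 ?addr0// => i.
  by rewrite -val_eqE/= => /negbTE ->.
rewrite big1// => i _; rewrite ltn_eqF//; exact: leq_trans Nk.
Qed.

End subprob.
Arguments subprobs {R}.

(** * Pietsch domination for diagonal operators, by minimax and compactness *)

Section pietsch.
Context (R : realType) (E : completeNormedModType R) (v : nat -> E).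
Context (r C C' : R) (r0 : 0 < r) (C0 : 0 <= C) (CC' : C < C').
Local Notation comb N s := (\sum_(n < N) (s : nat -> R) n *: v n).

(* The operator s |-> \sum_n s_n v_n on finitely supported sequences is
   r-summing with constant C. *)
Hypothesis vC : forall N m (s : 'I_m -> nat -> R) M, 0 <= M ->
  (forall n, (n < N)%N -> \sum_i `|s i n| `^ r <= M) ->
  \sum_i `|comb N (s i)| `^ r <= C `^ r * M.

(** The slack in the domination inequality for the vector [s]. It is affine in the weights [l], as
    [convex_alternative] requires. *)
Let gap (N : nat) (s l : nat -> R) :=
  C' `^ r * (\sum_(n < N) l n * `|s n| `^ r) - `|comb N s| `^ r.

Let gap_affine N s (x y : nat -> R) t :
  gap N s (t *: x + (1 - t) *: y) = t * gap N s x + (1 - t) * gap N s y.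
Proof.
rewrite /gap; have E' n : (t *: x + (1 - t) *: y) n = t * x n + (1 - t) * y n by [].
under eq_bigr do rewrite E' mulrDl -!mulrA.
rewrite big_split/= -!mulr_sumr; ring.
Qed.

Let gap_widen N N' s l : (N <= N')%N ->
  gap N s l = gap N' (fun n => if (n < N)%N then s n else 0) l.
Proof.
move=> NN'; rewrite /gap; congr (_ * _ - _ `^ _).
  rewrite (big_ord_widen N' (fun n => l n * `|s n| `^ r))// big_mkcond/=.
  apply: eq_bigr => i _; case: ifP => //.
  by rewrite normr0 powR0 ?mulr0// gt_eqF.
congr (`| _ |); rewrite (big_ord_widen N' (fun n => s n *: v n))// big_mkcond/=.
by apply: eq_bigr => i _; case: ifP => //; rewrite scale0r.
Qed.

(** By [convex_alternative] it is enough to make each weighted sum of gaps positive at some [l]. The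
    point mass at the coordinate where the weighted sum of the [|s i n| ^ r] is largest does this,
    by the summing inequality; nonzero vectors make that maximum positive. *)
Let gap_finite m (N : nat -> nat) (s : nat -> nat -> R) :
  (forall i, (i < m)%N -> exists2 n, (n < N i)%N & s i n != 0) ->
  exists2 l, subprobs l & forall i, (i < m)%N -> 0 <= gap (N i) (s i) l.
Proof.
move=> s0; refine (@convex_alternative R (nat -> R) m subprobs
  (fun i => gap (N i) (s i)) _ _ _ _).
- exact: subprobs_convex.
- by move=> i x y t _; exact: gap_affine.
- by exists (fun n => (n == 0)%:R); exact: subprobs_delta.
move=> w w0 [j jm wj].
(* A common length for all the vectors; the successor makes ['I_N'] inhabited, so that a maximizer
   exists. *)
pose N' := (\max_(i < m) N i).+1.
have NN' (i : 'I_m) : (N i <= N')%N.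
  by apply: leqW; exact: (leq_bigmax (F := fun i : 'I_m => N i)).
pose s' i n := if (n < N i)%N then s i n else 0.
pose F (n : 'I_N') := \sum_(i < m) w i * `|s' i n| `^ r.
have [k _ kmax] := @Order.TotalTheory.arg_maxP _ _ _ ord0 xpredT F isT.
exists (fun n => (n == k :> nat)%:R); first exact: subprobs_delta.
have Fk : 0 < F k.
  have [n nN sn] := s0 j jm.
  apply: lt_le_trans (kmax (Ordinal (leq_trans nN (NN' (Ordinal jm)))) isT).
  rewrite /F (bigD1 (Ordinal jm))//= ltr_pwDl//; last first.
    by apply: sumr_ge0 => i _; rewrite mulr_ge0// powR_ge0.
  by rewrite mulr_gt0// powR_gt0// normr_gt0 /s' nN.
have sumk i : \sum_(n < N') (n == k :> nat)%:R * `|s' i n| `^ r = `|s' i k| `^ r.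
  rewrite (bigD1 k)//= eqxx mul1r big1 ?addr0// => n.
  by rewrite -val_eqE/= => /negbTE ->; rewrite mul0r.
have -> : \sum_(i < m) w i * gap (N i) (s i) (fun n => (n == k :> nat)%:R) =
    C' `^ r * F k - \sum_(i < m) w i * `|comb N' (s' i)| `^ r.
  rewrite /F mulr_sumr -sumrB; apply: eq_bigr => i _.
  by rewrite (gap_widen _ _ (NN' i)) /gap -/(s' i) sumk; ring.
have wr (i : nat) : (w i `^ r^-1) `^ r = w i.
  by rewrite -powRrM mulVf ?gt_eqF// powRr1.
(* The weights are absorbed into the vectors, since [vC] carries none. *)
pose u (i : 'I_m) n := w i `^ r^-1 * s' i n.
have := @vC N' m u (F k) (ltW Fk).
have -> : \sum_(i < m) `|comb N' (u i)| `^ r =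
    \sum_(i < m) w i * `|comb N' (s' i)| `^ r.
  apply: eq_bigr => i _; rewrite /u; under eq_bigr do rewrite -scalerA.
  by rewrite -scaler_sumr normrZ ger0_norm ?powR_ge0// powRM ?powR_ge0// wr.
rewrite subr_gt0 => H; apply: le_lt_trans (H _) _ => [n nN|].
  apply: le_trans (kmax (Ordinal nN) isT); rewrite /F.
  apply: ler_sum => i _; rewrite /u normrM ger0_norm ?powR_ge0//.
  by rewrite powRM ?powR_ge0// wr.
(* Strictness comes from [C < C'] together with [0 < F k]. *)
by rewrite ltr_pM2r// gt0_ltr_powR// nnegrE// ltW// (le_lt_trans C0).
Qed.

(* The constraints 0 <= gap N s l define closed subsets of a compact set, and
   finitely many of them can be met at once by [gap_finite]. *)
Lemma pietsch_domination : exists2 l, subprobs l &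
  forall N s, `|comb N s| `^ r <= C' `^ r * \sum_(n < N) l n * `|s n| `^ r.
Proof.
pose I : choiceType := (nat * (nat -> R))%type.
pose D : set I := [set i | exists2 n, (n < i.1)%N & i.2 n != 0].
pose f (i : I) : set {ptws nat -> R} := subprobs `&` [set l | 0 <= gap i.1 i.2 l].
have fI : finI D f.
  move=> D' D'D.
  have D'P i : (i < size D')%N -> D (nth (0, 0) D' i).
    by move=> iD'; apply/set_mem/D'D; rewrite mem_nth.
  have [l Ll lP] := @gap_finite (size D') (fun i => (nth (0, 0) D' i).1)
    (fun i => (nth (0, 0) D' i).2) D'P.
  exists l => i /= iD'; split => //=.
  by have := lP (index i D'); rewrite index_mem nth_index//; apply.
have FF := finI_filter fI.
have fD i : D i -> filter_from (finI_from D f) id (f i).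
  by move=> Di; exists (f i) => //; exact: finI_from1.
(* The constraint of the nonzero vector [cst 1] of length 1 shows that the filter contains
   [subprobs]; compactness then yields a cluster point [l]. *)
have [|l [Ll cl]] := subprobs_compact FF.
  apply: filterS (fD (1, cst 1) _) => [l []//|].
  by exists 0 => //=; rewrite oner_neq0.
exists l => // N s.
have [[n nN sn]|s0] := pselect (exists2 n, (n < N)%N & s n != 0); last first.
  have s0' (n : 'I_N) : s n = 0.
    by apply: contrapT => /eqP sn; apply: s0; exists n.
  rewrite !big1 ?mulr0 ?normr0 ?powR0 ?gt_eqF// => n _.
    by rewrite s0' normr0 powR0 ?mulr0// gt_eqF.
  by rewrite s0' scale0r.
(* A closed set that meets every neighbourhood of the cluster point [l] contains it. *)
suff : closed [set l : {ptws nat -> R} | 0 <= gap N s l].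
  rewrite -subr_ge0; apply => B lB.
  have [y [[_ fy] By]] := cl _ _ (fD (N, s) (ex_intro2 _ _ n nN sn)) lB.
  by exists y.
rewrite [X in closed X](_ : _ = (fun l : {ptws nat -> R} =>
    \sum_(n < N) l n * `|s n| `^ r) @^-1`
    [set x | `|comb N s| `^ r / C' `^ r <= x]).
  apply: preimage_closed; last exact: closed_ge.
  by move=> ? _; exact: (@weighted_sum_continuous _ N (fun n => `|s n| `^ r)).
have C'0 : 0 < C' `^ r by rewrite powR_gt0// (le_lt_trans C0).
by apply/seteqP; split=> y /=; rewrite /gap subr_ge0 ler_pdivrMr// mulrC.
Qed.

End pietsch.

(** * Concavity and convergence along the basis *)

Section unconditional_basis.
Context (R : realType) (E : completeNormedModType R) (e : nat -> E).
Context (he : normalized_unconditional1_basis e).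

Lemma trunc_series_cvg N (c : nat -> R) :
  series (fun j => (if (j < N)%N then c j else 0) *: e j) @ \oo -->
    \sum_(n < N) c n *: e n.
Proof.
apply: cvg_near_cst; exists N => // m /= Nm; rewrite /series/=.
rewrite big_mkord (big_ord_widen m (fun n => c n *: e n))// [RHS]big_mkcond/=.
by apply: eq_bigr => i _; case: ifP => //; rewrite scale0r.
Qed.

Lemma coord_sum N (c : nat -> R) :
  Defs.coord he (\sum_(n < N) c n *: e n) = fun j => if (j < N)%N then c j else 0.
Proof.
apply: (basis_unique he); first exact: coord_cvg.
exact: trunc_series_cvg.
Qed.

(** Concavity is tested on the family whose only member is [e 0], for which both norms equal 1. *)
Lemma q_concave_with_ge1 q K : (1 <= q)%E -> q_concave_with he q K -> 1 <= K.
Proof.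
move=> q1 /(_ 1%N (fun=> e 0%N)).
have e0E : e 0%N = \sum_(n < 1) (cst 1 : nat -> R) n *: e n.
  by rewrite big_ord1 scale1r.
have lqE s : lq_norm q (fun _ : 'I_1 => s) = `|s|.
  case: q q1 => [r||]//= r1.
    rewrite big_ord1 -powRrM mulfV ?powRr1// gt_eqF// (lt_le_trans ltr01)//.
  by rewrite big_ord_recl big_ord0 max_l.
rewrite lqE (basis_normalized he) normr1.
suff -> : lattice_lq he q (fun _ : 'I_1 => e 0%N) = e 0%N.
  by rewrite (basis_normalized he) mulr1.
rewrite /lattice_lq; under eq_fun do rewrite lqE e0E coord_sum.
rewrite [RHS]e0E; apply: (cvg_lim (@norm_hausdorff _ _)).
rewrite (_ : (fun j => _) =
  (fun j => (if (j < 1)%N then (cst 1 : nat -> R) j else 0) *: e j)).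
  exact: trunc_series_cvg.
by apply/funext => j; case: ifP; rewrite ?normr1 ?normr0.
Qed.

(** Concavity bounds the [l_r] norm of the norms by [K] times the norm of a lattice element. For
    [j < N] its coordinate is [(\sum_i |s i j| ^ r) ^ (1 / r) * b j], at most [M ^ (1 / r) * b j];
    the other coordinates vanish, and unconditionality concludes. *)
Lemma concave_summing (r K : R) (b : nat -> R) : 1 <= r ->
  q_concave_with he r%:E K -> (forall n, 0 <= b n) ->
  cvgn (series (fun n => b n *: e n)) ->
  forall N m (s : 'I_m -> nat -> R) M, 0 <= M ->
  (forall n, (n < N)%N -> \sum_i `|s i n| `^ r <= M) ->
  \sum_i `|\sum_(n < N) s i n *: (b n *: e n)| `^ r <=
    (K * `|limn (series (fun n => b n *: e n))|) `^ r * M.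
Proof.
move=> r1 Kc b0 bc N m s M M0 sM; have r0 : 0 < r by rewrite (lt_le_trans ltr01).
have K0 : 0 <= K by rewrite (le_trans ler01) // (q_concave_with_ge1 _ Kc).
set B := limn _.
pose x i := \sum_(n < N) (s i n * b n) *: e n.
have xE i : \sum_(n < N) s i n *: (b n *: e n) = x i.
  by apply: eq_bigr => n _; rewrite scalerA.
under eq_bigr do rewrite xE.
have S0 : 0 <= \sum_i `|x i| `^ r by apply: sumr_ge0 => i _; exact: powR_ge0.
have rK u : 0 <= u -> (u `^ r^-1) `^ r = u.
  by move=> u0; rewrite -powRrM mulVf ?gt_eqF// powRr1.
rewrite -[leLHS]rK// -[X in _ * X]rK// -powRM ?powR_ge0 ?mulr_ge0//.
apply: ge0_ler_powR; rewrite ?nnegrE ?powR_ge0 ?(ltW r0) ?mulr_ge0 ?powR_ge0//.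
have := Kc m x; rewrite /lq_norm; under [in leLHS]eq_bigr do rewrite normr_id.
move=> /le_trans; apply; rewrite -mulrA ler_wpM2l//.
have ZB := @coef_seriesZ _ _ e (M `^ r^-1) _ bc.
rewrite -/B in ZB.
have -> : `|B| * M `^ r^-1 = `|limn (series (fun j => (M `^ r^-1 * b j) *: e j))|.
  rewrite (cvg_lim (@norm_hausdorff _ _) ZB) normrZ mulrC.
  by rewrite ger0_norm ?powR_ge0.
apply: (unconditional_lim_le he) => [j|]; last exact: cvgP ZB.
rewrite !ger0_norm ?lq_norm_ge0 ?mulr_ge0 ?powR_ge0//.
rewrite /lq_norm /x; under eq_bigr do rewrite (coord_sum N (fun n => s _ n * b n)).
have [jN|Nj] := ltnP j N; last first.
  rewrite big1 => [|i _]; last by rewrite normr0 powR0// gt_eqF.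
  by rewrite powR0 ?mulr_ge0 ?powR_ge0// invr_eq0 gt_eqF.
have -> : \sum_i `|s i j * b j| `^ r = (\sum_i `|s i j| `^ r) * b j `^ r.
  rewrite mulr_suml; apply: eq_bigr => i _.
  by rewrite normrM powRM// (ger0_norm (b0 j)).
rewrite powRM ?powR_ge0 ?sumr_ge0//.
rewrite -powRrM mulfV ?gt_eqF// powRr1// ler_wpM2r//.
apply: ge0_ler_powR; rewrite ?nnegrE ?invr_ge0 ?(ltW r0)//; last exact: sM.
by apply: sumr_ge0 => i _; exact: powR_ge0.
Qed.

(** Domination applied to blocks of [t] transfers the Cauchy criterion from the scalar series of the
    [l n * |t n| ^ r]; applied to initial segments, it bounds the limit. *)
Lemma dominated_coef_cvg (r C M : R) (b l t : nat -> R) : 1 <= r ->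
  0 <= C -> 0 <= M -> (forall n, 0 <= l n) ->
  (forall N (s : nat -> R), `|\sum_(n < N) s n *: (b n *: e n)| `^ r <=
    C `^ r * \sum_(n < N) l n * `|s n| `^ r) ->
  (forall N, \sum_(n < N) l n * `|t n| `^ r <= M `^ r) ->
  cvgn (series (fun n => (b n * t n) *: e n)) /\
  `|limn (series (fun n => (b n * t n) *: e n))| <= C * M.
Proof.
move=> r1 C0 M0 l0 dom tM; have r0 : 0 < r by rewrite (lt_le_trans ltr01).
have rK u : 0 <= u -> (u `^ r^-1) `^ r = u.
  by move=> u0; rewrite -powRrM mulVf ?gt_eqF// powRr1.
have le_r u w : 0 <= u -> 0 <= w -> u `^ r <= w `^ r -> u <= w.
  move=> u0 w0 uw; rewrite leNgt; apply/negP => wu.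
  by move: uw; rewrite leNgt gt0_ltr_powR.
have tc : cvgn (series (fun n => l n * `|t n| `^ r)).
  apply: nondecreasing_is_cvgn.
    by apply: nondecreasing_series => i _ _; rewrite mulr_ge0 ?powR_ge0.
  by exists (M `^ r) => _ [N _ <-]; rewrite /series/= big_mkord.
suff sc : cvgn (series (fun n => (b n * t n) *: e n)).
  split => //; rewrite -lim_norm//.
  apply: limr_le; first exact: is_cvg_norm.
  apply: nearW => N; apply: le_r; rewrite ?mulr_ge0// powRM//.
  rewrite /series/= big_mkord; under eq_bigr do rewrite mulrC -scalerA.
  by apply: le_trans (dom N t) _; rewrite ler_wpM2l// powR_ge0.
have blk (V : zmodType) (F : nat -> V) m n : \sum_(m <= k < n) F k =
    \sum_(k < n) if (m <= k)%N then F k else 0.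
  by rewrite (big_nat_widenl m 0)//= big_mkcond/= big_mkord.
have block m n : `|\sum_(m <= k < n) (b k * t k) *: e k| `^ r <=
    C `^ r * \sum_(m <= k < n) l k * `|t k| `^ r.
  have := dom n (fun k => if (m <= k)%N then t k else 0).
  rewrite !blk; congr (`| _ | `^ _ <= _ * _); apply: eq_bigr => k _; case: ifP => _.
  - by rewrite scalerA mulrC.
  - by rewrite scale0r.
  - by [].
  - by rewrite normr0 powR0 ?mulr0// gt_eqF.
apply/cauchy_cvgP/cauchy_seriesP => eps eps0.
(* Dividing by [C + 1] covers the case [C = 0] and keeps [C * (eps / (C + 1))] strictly below
   [eps]. *)
have C1 : 0 < C + 1 by rewrite ltr_wpDl.
have d0 : 0 < eps / (C + 1) by rewrite divr_gt0.
move/cauchy_cvgP/cauchy_seriesP : tc => /(_ ((eps / (C + 1)) `^ r)).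
rewrite powR_gt0// => /(_ isT); apply: filterS => -[m n] /= H.
apply: (@le_lt_trans _ _ (C * (eps / (C + 1)))).
  apply: le_r => //; first exact: mulr_ge0 C0 (ltW d0).
  rewrite powRM ?(ltW d0)//.
  apply: le_trans (block m n) _; rewrite ler_wpM2l ?powR_ge0//.
  exact: le_trans (ler_norm _) (ltW H).
by rewrite mulrCA gtr_pMr// ltr_pdivrMr// mul1r ltrDl.
Qed.

(** An infimum of costs need not be attained, so every coefficient must be strictly increased. The
    increments [d / 2 ^ n] are absolutely summable along the normalized basis, and a small [d] keeps
    their total norm below [eps]. *)
Lemma perturbed_coef (a : nat -> R) (eps : R) : 0 < eps -> (forall n, 0 <= a n) ->
  cvgn (series (fun n => a n *: e n)) ->
  exists b : nat -> R, [/\ forall n, a n < b n,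
    cvgn (series (fun n => b n *: e n)) &
    `|limn (series (fun n => b n *: e n))| <=
      `|limn (series (fun n => a n *: e n))| + eps].
Proof.
move=> eps0 a0 ac; pose c n : R := geometric 1 (1 / 2) n.
have c0 n : 0 < c n by rewrite /c/= mul1r exprn_gt0.
have cc : cvgn (series (fun n => c n *: e n)).
  apply: normed_cvg.
  rewrite (_ : [normed _] = series (geometric 1 (1 / 2))).
    by apply: is_cvg_geometric_series; rewrite ger0_norm//; lra.
  apply/funext => n; apply: eq_bigr => i _.
  by rewrite /= normrZ (basis_normalized he) mulr1 gtr0_norm.
set v := limn (series (fun n => c n *: e n)).
pose d := eps / (`|v| + 1).
have v1 : 0 < `|v| + 1 by rewrite ltr_wpDl.
have d0 : 0 < d by rewrite divr_gt0.
have dc := coef_seriesZ (c := d) cc.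
have bc := coef_seriesD ac (cvgP _ dc).
exists (fun n => a n + d * c n); split.
- by move=> n; rewrite ltrDl mulr_gt0.
- exact: cvgP bc.
rewrite (cvg_lim (@norm_hausdorff _ _) bc) (cvg_lim (@norm_hausdorff _ _) dc).
apply: le_trans (ler_normD _ _) _; rewrite lerD2l normrZ gtr0_norm// -/v.
by rewrite /d mulrAC ler_pdivrMr// ler_pM2l// lerDl.
Qed.

End unconditional_basis.

(** The subprobability given by [pietsch_domination] is divided by its total mass [L]. Positive
    weights ensure that null sets of the disjoint union are null in every component. *)
Lemma probability_domination (R : realType) (E : completeNormedModType R)
    (e : nat -> E) (he : normalized_unconditional1_basis e) (r K C' : R)
    (b : nat -> R) : 1 <= r ->
  q_concave_with he r%:E K -> (forall n, 0 < b n) ->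
  cvgn (series (fun n => b n *: e n)) ->
  K * `|limn (series (fun n => b n *: e n))| < C' ->
  exists lam : nat -> R, [/\ forall n, 0 < lam n,
    (\sum_(n <oo) (lam n)%:E = 1)%E &
    forall N (s : nat -> R), `|\sum_(n < N) s n *: (b n *: e n)| `^ r <=
      C' `^ r * \sum_(n < N) lam n * `|s n| `^ r].
Proof.
move=> r1 Kc b0 bc CC'; have r0 : 0 < r by rewrite (lt_le_trans ltr01).
have K0 : 0 <= K by rewrite (le_trans ler01) // (q_concave_with_ge1 _ Kc).
have C0 : 0 <= K * `|limn (series (fun n => b n *: e n))| by rewrite mulr_ge0.
have C'0 : 0 < C' `^ r by rewrite powR_gt0// (le_lt_trans C0).
have [l [l0 l1] dom] := @pietsch_domination R E (fun n => b n *: e n)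
  _ _ _ r0 C0 CC' (concave_summing r1 Kc (fun n => ltW (b0 n)) bc).
(* Tested on the unit vector at [n], domination bounds [b n ^ r > 0] by [C' ^ r * l n]. *)
have lp n : 0 < l n.
  have := dom n.+1 (fun k => (k == n)%:R).
  rewrite (bigD1 ord_max)//= eqxx scale1r big1 ?addr0; last first.
    by move=> i; rewrite -val_eqE/= => /negbTE ->; rewrite scale0r.
  rewrite (bigD1 ord_max)//= eqxx normr1 powR1 mulr1 big1 ?addr0; last first.
    move=> i; rewrite -val_eqE/= => /negbTE ->.
    by rewrite normr0 powR0 ?mulr0// gt_eqF.
  rewrite normrZ (basis_normalized he) mulr1 gtr0_norm//.
  by move=> /(lt_le_trans (powR_gt0 r (b0 n))); rewrite pmulr_rgt0.
have lc : cvgn (series l).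
  apply: nondecreasing_is_cvgn.
    by apply: nondecreasing_series => i _ _; exact: ltW.
  by exists 1 => _ [N _ <-]; rewrite /series/= big_mkord.
have L1 : limn (series l) <= 1.
  by apply: limr_le => //; apply: nearW => N; rewrite /series/= big_mkord.
have L0 : 0 < limn (series l).
  apply: lt_le_trans (lp 0%N) _; apply: limr_ge => //; exists 1%N => // N /= N0.
  rewrite /series/= big_mkord (bigD1 (Ordinal N0))//= lerDl.
  by rewrite sumr_ge0// => i _; exact: ltW.
set L := limn (series l) in L0 L1.
exists (fun n => l n / L); split=> [n||N s]; first by rewrite divr_gt0.
- apply/cvg_lim => //.
  rewrite (_ : (fun n => _) = EFin \o (fun N => series l N * L^-1)).
    have -> : 1%E = (L * L^-1)%:E :> \bar R by rewrite mulfV// gt_eqF.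
    apply: cvg_EFin; first exact: nearW.
    exact: (cvgM lc (cvg_cst L^-1)).
  by apply/funext => N; rewrite sumEFin /series/= mulr_suml.
(* Since [L <= 1], dividing by [L] only increases the weights. *)
- apply: le_trans (dom N s) _; rewrite ler_pM2l//; apply: ler_sum => n _.
  by rewrite ler_wpM2r ?powR_ge0// ler_pdivlMr// ler_piMr// ltW.
Qed.

(** * Disjoint unions of measure spaces *)

Definition disjoint_union (d : nat -> measure_display)
  (Om : forall n, measurableType (d n)) := {n : nat & Om n}.

Section disjoint_union.
Context (d : nat -> measure_display) (Om : forall n, measurableType (d n)).
Local Notation U := (disjoint_union Om).

Definition component n (x : Om n) : U := existT _ n x.

HB.instance Definition _ := gen_eqMixin U.
HB.instance Definition _ := gen_choiceMixin U.
HB.instance Definition _ := isPointed.Build U (@component 0%N point).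

(** The largest sigma-algebra that makes every [component] measurable. *)
Definition union_measurable : set (set U) :=
  [set A | forall n, measurable (@component n @^-1` A)].

Lemma union_measurable0 : union_measurable set0.
Proof. by move=> n; rewrite preimage_set0. Qed.

Lemma union_measurableC A : union_measurable A -> union_measurable (~` A).
Proof. by move=> mA n; rewrite preimage_setC; exact: measurableC. Qed.

Lemma union_measurable_bigcup (F : (set U)^nat) :
  (forall i, union_measurable (F i)) -> union_measurable (\bigcup_i F i).
Proof.
by move=> mF n; rewrite preimage_bigcup; apply: bigcup_measurable => i _; exact: mF.
Qed.

HB.instance Definition _ := isMeasurable.Build default_measure_display U
  union_measurable0 union_measurableC union_measurable_bigcup.

Lemma measurable_unionE (A : set U) :
  measurable A = forall n, measurable (@component n @^-1` A).
Proof. by []. Qed.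

Lemma measurable_component n : measurable_fun setT (@component n).
Proof. by move=> _ A mA; rewrite setTI; exact: mA. Qed.

Lemma measurable_fun_union d' (T : measurableType d') (f : U -> T) :
  (forall n, measurable_fun setT (f \o @component n)) -> measurable_fun setT f.
Proof.
move=> mf _ A mA; rewrite setTI measurable_unionE => n.
have := mf n measurableT A mA.
by rewrite setTI comp_preimage.
Qed.

Context (R : realType) (mu : forall n, {measure set Om n -> \bar R}).
Context (lam : nat -> R) (lam0 : forall n, 0 < lam n).

Definition component_measure n : set U -> \bar R :=
  pushforward (mu n) (@component n).

Lemma component_measure0 n : component_measure n set0 = 0%E.
Proof. exact: (measure0 (mu n)). Qed.

Lemma component_measure_ge0 n A : (0 <= component_measure n A)%E.
Proof. exact: (measure_ge0 (mu n)). Qed.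

Lemma component_measure_sigma_additive n :
  semi_sigma_additive (component_measure n).
Proof.
move=> F mF tF mUF; rewrite /component_measure /pushforward preimage_bigcup.
apply: measure_semi_sigma_additive.
- by move=> i; exact: mF.
- apply/trivIsetP => i j _ _ ij; rewrite -preimage_setI.
  by move/trivIsetP : tF => /(_ _ _ _ _ ij) ->//; rewrite preimage_set0.
- by rewrite -preimage_bigcup; exact: mUF.
Qed.

HB.instance Definition _ n := isMeasure.Build _ _ _ (component_measure n)
  (component_measure0 n) (@component_measure_ge0 n)
  (@component_measure_sigma_additive n).

Definition sum_measure : set U -> \bar R :=
  mseries (fun n => mscale (NngNum (ltW (lam0 n))) (component_measure n)) 0.

HB.instance Definition _ := Measure.on sum_measure.

Lemma sum_measureE A : sum_measure A =
  (\sum_(n <oo) (lam n)%:E * mu n (@component n @^-1` A))%E.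
Proof. by []. Qed.

(** As every [lam n] is positive, a null set of the sum has null traces. Conversely, null sets
    chosen in the components are glued into one. *)
Lemma ae_union (P : U -> Prop) : (\forall x \ae sum_measure, P x) <->
  forall n, \forall x \ae mu n, P (component x).
Proof.
split=> [[A [mA A0 PA]] n|H].
  exists (@component n @^-1` A); split => //; last by move=> x /= Px; exact: PA.
  have : (\sum_(0 <= k < n.+1) (lam k)%:E * mu k (@component k @^-1` A) <= 0)%E.
    rewrite -[leRHS]A0 sum_measureE; apply: nneseries_lim_ge => k _ _.
    by rewrite mule_ge0// lee_fin ltW.
  rewrite big_nat_recr//= => le0; apply/eqP; rewrite -measure_le0.
  rewrite -(@pmule_rle0 _ (lam n)%:E) ?lte_fin//; apply: le_trans le0.
  by rewrite leeDr// sume_ge0// => k _; rewrite mule_ge0// lee_fin ltW.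
pose A n := sval (cid (H n)).
have AP n : [/\ measurable (A n), mu n (A n) = 0%E &
  ~` [set x | P (component x)] `<=` A n] by rewrite /A; case: cid.
exists [set x | A (tag x) (tagged x)]; split.
- by rewrite measurable_unionE => n; by have [] := AP n.
- rewrite sum_measureE eseries0// => n _ _.
  by have [_ A0 _] := AP n; rewrite A0 mule0.
- by case=> n x /= Px; have [_ _ PA] := AP n; exact: PA.
Qed.

Lemma ge0_integral_sum_measure (f : U -> \bar R) :
  measurable_fun setT f -> (forall x, 0 <= f x)%E ->
  (\int[sum_measure]_x f x =
   \sum_(n <oo) (lam n)%:E * \int[mu n]_x f (component x))%E.
Proof.
move=> mf f0; rewrite ge0_integral_measure_series//.
apply: eq_eseriesr => n _; rewrite ge0_integral_mscale//; congr (_ * _)%E.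
rewrite ge0_integral_pushforward//; exact: measurable_component.
Qed.

End disjoint_union.

(** * Classes of functions handled almost everywhere *)

Section Lspace_ae.
Context d (T : measurableType d) (R : realType) (mu : {measure set T -> \bar R}).

Section anyp.
Context (p : \bar R) (p1 : (1 <= p)%E).
Local Notation L := (LspaceType mu p1).

Lemma Lspace_eqP (f g : L) : f = g <-> (f : T -> R) = g %[ae mu].
Proof.
split=> [->|fg]; first exact: aeW.
by rewrite -(Lspace_reprK f) -(Lspace_reprK g); apply/Lspace_classP.
Qed.

(** The operations return the class of a pointwise combination, whose chosen representative agrees
    with that combination only almost everywhere. *)
Lemma Lspace_linear_ae (a : R) (f g : L) :
  (a *: f + g : L) = (fun x => a * f x + g x) %[ae mu].
Proof.
have H1 := Lfun_class_ae (Lspace_repr (a *: f : L) + Lspace_repr g).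
have H2 := Lfun_class_ae (a *: Lspace_repr f).
by apply: filterS2 H1 H2 => x /(_ I) H1 /(_ I) H2 _;
  exact: (etrans H1 (congr1 (+%R^~ (g x)) H2)).
Qed.

Lemma Lspace_normEFin (f : L) : (`|f|)%:E = 'N[mu]_p[EFin \o f]%E.
Proof. exact: (@finite_norm_fine _ _ _ _ _ _ (Lspace_repr f)). Qed.

End anyp.

Lemma Lnorm_infty_le (f : T -> R) (M : R) : 0 <= M ->
  ('N[mu]_+oo[EFin \o f] <= M%:E)%E <-> \forall x \ae mu, `|f x| <= M.
Proof.
move=> M0; rewrite unlock /Lnorm; case: ifPn => mu0.
  by split=> [/ess_supP|fM]; [|apply/ess_supP].
(* On a space of total mass 0 the norm is 0 by convention, and every property holds almost
   everywhere. *)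
split=> _; last by rewrite lee_fin.
apply: measure0_ae; apply/eqP; rewrite -measure_le0 leNgt; exact: mu0.
Qed.

Lemma Linfty_norm_le (f : LspaceType mu (leey 1%E)) (M : R) : 0 <= M ->
  `|f| <= M <-> \forall x \ae mu, `|f x| <= M.
Proof. by move=> M0; rewrite -Lnorm_infty_le// -Lspace_normEFin lee_fin. Qed.

Lemma Lspace_class_fun (p : \bar R) (p1 : (1 <= p)%E) (f : T -> R) :
  f \in Lfun mu p -> exists g : LspaceType mu p1, (g : T -> R) = f %[ae mu].
Proof.
by move=> fL; exists (Lspace_class (Lfun_Sub p1 fL)); exact: Lfun_class_ae.
Qed.

Lemma bounded_Lfun_infty (f : T -> R) (M : R) : 0 <= M -> measurable_fun setT f ->
  (\forall x \ae mu, `|f x| <= M) -> f \in Lfun mu +oo%E.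
Proof.
move=> M0 mf fM; apply/andP; split; rewrite inE//=.
by rewrite /finite_norm (@le_lt_trans _ _ M%:E)// ?ltry//; apply/Lnorm_infty_le.
Qed.

End Lspace_ae.

Lemma Linfty_inclE d (T : measurableType d) (R : realType) (P : probability T R)
    (q : \bar R) (q1 : (1 <= q)%E) (f : LspaceType P (leey 1%E)) :
  (Linfty_incl q1 f : T -> R) = f.
Proof. by rewrite Linfty_incl_sort. Qed.

(** * Restriction to the components and gluing *)

Section restriction.
Context (d : nat -> measure_display) (Om : forall n, measurableType (d n)).
Context (R : realType) (mu : forall n, {measure set Om n -> \bar R}).
Context (lam : nat -> R) (lam0 : forall n, 0 < lam n).
Local Notation U := (disjoint_union Om).
Local Notation nu := (sum_measure mu lam0).

Lemma poweR_Lnorm_sum (r : R) (f : U -> R) : r != 0 -> measurable_fun setT f ->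
  ('N[nu]_r%:E[EFin \o f] `^ r = \sum_(n <oo)
    (lam n)%:E * 'N[mu n]_r%:E[EFin \o (f \o @component _ Om n)] `^ r)%E.
Proof.
move=> r0 mf; rewrite poweR_Lnorm// ge0_integral_sum_measure//.
- by apply: eq_eseriesr => n _; rewrite poweR_Lnorm.
- apply: (@measurableT_comp _ _ _ _ _ _ (fun x : \bar R => x `^ r)%E).
    exact: measurable_poweR.
  by apply: measurableT_comp => //; exact/measurable_EFinP.
- by move=> x; exact: poweR_ge0.
Qed.

Section anyp.
Context (p : \bar R) (p1 : (1 <= p)%E).

(** For finite [p], [lam n] times the [p]-th power of the norm on component [n] is one term of a
    nonnegative series with finite sum; for [p = +oo], an almost everywhere bound passes to the
    components. *)
Lemma component_Lfun n (f : LspaceType nu p1) :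
  (f \o @component _ Om n : Om n -> R) \in Lfun (mu n) p.
Proof.
have mf := Lspace_measurable f.
have mfn : measurable_fun setT (f \o @component _ Om n : Om n -> R).
  by apply: measurableT_comp => //; exact: measurable_component.
apply/andP; split; rewrite inE//=.
have := Lspace_normEFin f; move: (`|f|) => M fM.
rewrite /finite_norm; move: p1 f mf mfn fM.
case: p => [r r1|y1|//] f mf mfn fM; last first.
  have M0 : 0 <= M by rewrite -lee_fin fM Lnorm_ge0.
  apply: (le_lt_trans _ (ltry M)).
  apply/(Lnorm_infty_le (mu n) _ M0).
  have : \forall x \ae nu, `|f x| <= M by apply/(Lnorm_infty_le _ _ M0); rewrite fM.
  by move=> /ae_union.
have r0 : 0 < r by rewrite (lt_le_trans ltr01).
apply: (@lty_poweRy _ _ r); first by rewrite gt_eqF.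
have := poweR_Lnorm_sum (lt0r_neq0 r0) mf; rewrite -fM poweR_EFin => E.
have le : (\sum_(0 <= k < n.+1) (lam k)%:E *
    'N[mu k]_r%:E[EFin \o (f \o @component _ Om k)] `^ r <= (M `^ r)%:E)%E.
  rewrite E; apply: nneseries_lim_ge => k _ _.
  by rewrite mule_ge0 ?lee_fin ?(ltW (lam0 k))// poweR_ge0.
rewrite big_nat_recr//= in le.
rewrite -(@lte_pmul2l _ (lam n)%:E) ?lte_fin// gt0_muley ?lte_fin//.
apply: (le_lt_trans _ (ltry (M `^ r))); apply: (le_trans _ le).
rewrite leeDr// sume_ge0// => k _.
by rewrite mule_ge0 ?poweR_ge0// lee_fin ltW.
Qed.

(* This depends only on the class of f because lam n > 0. *)
Definition restriction n (f : LspaceType nu p1) : LspaceType (mu n) p1 :=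
  Lspace_class (Lfun_Sub p1 (component_Lfun n f)).

Lemma restriction_ae n (f : LspaceType nu p1) :
  (restriction n f : Om n -> R) = f \o @component _ Om n %[ae mu n].
Proof. exact: Lfun_class_ae. Qed.

Lemma restriction_linear n : linear (@restriction n).
Proof.
move=> a f g; apply/Lspace_eqP.
have /ae_union/(_ n) fg := Lspace_linear_ae a f g.
have rfg := restriction_ae n (a *: f + g).
have rl := Lspace_linear_ae a (restriction n f) (restriction n g).
have rf := restriction_ae n f; have rg := restriction_ae n g.
near=> x => _; rewrite (near rfg x)// (near rl x)//=.
rewrite (near fg x)//; congr (_ * _ + _).
  by rewrite (near rf x).
by rewrite (near rg x).
Unshelve. all: by end_near. Qed.

HB.instance Definition _ n := GRing.isLinear.Build R (LspaceType nu p1)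
  (LspaceType (mu n) p1) *:%R (@restriction n) (@restriction_linear n).

(** Gluing is thus unique, which is what makes the glued operator linear. *)
Lemma restriction_inj (f g : LspaceType nu p1) :
  (forall n, restriction n f = restriction n g) -> f = g.
Proof.
move=> fg; apply/Lspace_eqP/ae_union => n.
have rf := restriction_ae n f; have rg := restriction_ae n g.
by apply: filterS2 rf rg => x /(_ I) rf /(_ I) rg _; rewrite -[LHS]rf -[RHS]rg fg.
Qed.

End anyp.

Lemma restriction_infty_norm n (f : LspaceType nu (leey 1%E)) :
  `|restriction n f| <= `|f|.
Proof.
apply/Linfty_norm_le => //; have /Linfty_norm_le := lexx `|f|.
move=> /(_ (normr_ge0 _))/ae_union/(_ n) H; have rf := restriction_ae n f.
by apply: filterS2 H rf => x H /(_ I) ->.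
Qed.

(** A partial sum of [poweR_Lnorm_sum], in the form that [dominated_coef_cvg] takes as
    hypothesis. *)
Lemma restriction_norm_sum (r : R) (r1 : (1 <= r%:E)%E) (f : LspaceType nu r1) N :
  \sum_(n < N) lam n * `|restriction n f| `^ r <= `|f| `^ r.
Proof.
have r0 : r != 0 by rewrite gt_eqF// (lt_le_trans ltr01).
rewrite -lee_fin -sumEFin -poweR_EFin Lspace_normEFin.
rewrite poweR_Lnorm_sum//; last exact: Lspace_measurable.
rewrite -(big_mkord xpredT (fun n => (lam n * `|restriction n f| `^ r)%:E)).
apply: (le_trans _ (nneseries_lim_ge N _)); last first.
  by move=> n _ _; rewrite mule_ge0 ?lee_fin ?(ltW (lam0 n))// poweR_ge0.
apply: lee_sum => n _; rewrite EFinM -poweR_EFin Lspace_normEFin.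
rewrite (Lnorm_ae_eq r1 _ _ (restriction_ae n f))//; first exact: Lspace_measurable.
apply: measurableT_comp; [exact: Lspace_measurable|exact: measurable_component].
Qed.

(** The chosen representatives form one function on the disjoint union; the common bound [M] makes
    it essentially bounded. *)
Lemma glue_infty (F : forall n, LspaceType (mu n) (leey 1%E)) (M : R) :
  0 <= M -> (forall n, `|F n| <= M) ->
  exists f : LspaceType nu (leey 1%E),
    (forall n, restriction n f = F n) /\ `|f| <= M.
Proof.
move=> M0 FM; pose g (x : U) : R := (F (tag x) : Om (tag x) -> R) (tagged x).
have gM : \forall x \ae nu, `|g x| <= M.
  by apply/ae_union => n; apply/(Linfty_norm_le (F n) M0).
have mg : measurable_fun setT g.
  by apply: measurable_fun_union => n; exact: (Lspace_measurable (F n)).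
have [f fg] := Lspace_class_fun (leey 1%E) (bounded_Lfun_infty M0 mg gM).
exists f; split=> [n|].
  apply/Lspace_eqP; have rf := restriction_ae n f.
  move/ae_union : fg => /(_ n) fg.
  by apply: filterS2 rf fg => x /(_ I) rf /(_ I) fg _; rewrite [LHS]rf [LHS]fg.
by apply/Linfty_norm_le => //; apply: filterS2 fg gM => x /(_ I) ->.
Qed.

End restriction.

Section restriction_inclusion.
Context (d : nat -> measure_display) (Om : forall n, measurableType (d n)).
Context (R : realType) (mu : forall n, probability (Om n) R).
Context (lam : nat -> R) (lam0 : forall n, 0 < lam n).
Hypothesis lam1 : (\sum_(n <oo) (lam n)%:E = 1)%E.
Local Notation nu := (sum_measure (fun n => mu n : {measure set _ -> \bar R}) lam0).

Lemma sum_measure_setT : (nu setT = 1)%E.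
Proof.
rewrite sum_measureE -[RHS]lam1; apply: eq_eseriesr => n _.
rewrite preimage_setT -[RHS]mule1; congr (_ * _)%E; exact: probability_setT.
Qed.

Definition sum_probability : probability (disjoint_union Om) R :=
  HB.pack nu (Measure_isProbability.Build _ _ _ nu sum_measure_setT).

Lemma restriction_incl (q : \bar R) (q1 : (1 <= q)%E) n
    (f : LspaceType nu (leey 1%E)) :
  restriction n (Linfty_incl (P := sum_probability) q1 f : LspaceType nu q1) =
  Linfty_incl q1 (restriction n f).
Proof.
apply/Lspace_eqP.
have rf := restriction_ae n f.
have rj := restriction_ae n
  (Linfty_incl (P := sum_probability) q1 f : LspaceType nu q1).
apply: filterS2 rf rj => x /(_ I) rf /(_ I) rj _.
have -> : Linfty_incl q1 (restriction n f) x = restriction n f x.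
  by rewrite Linfty_inclE.
by rewrite [LHS]rj /= Linfty_incl_sort [RHS]rf.
Qed.

End restriction_inclusion.

(** * Factorizations *)

Section opnorm.
Context (R : realType) (V W : normedModType R) (f : {linear V -> W}).

Lemma opnorm_le C : 0 <= C -> (forall x, `|f x| <= C * `|x|) -> opnorm f <= C.
Proof.
move=> C0 fC; apply: ge_sup; first by exists `|f 0|, 0 => //=; rewrite normr0.
move=> _ [x /= x1 <-]; apply: le_trans (fC x) _.
by rewrite -[leRHS]mulr1 ler_wpM2l.
Qed.

Hypothesis fb : bounded_op f.

Lemma opnorm_ub x : `|x| <= 1 -> `|f x| <= opnorm f.
Proof.
move=> x1; apply: ub_le_sup; last by exists x.
have [M fM] := fb; exists `|M| => _ [y /= y1 <-].
apply: le_trans (fM y) _; rewrite -[leRHS]mulr1.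
by rewrite (le_trans (ler_wpM2r _ (ler_norm M)))// ler_wpM2l.
Qed.

Lemma opnorm_ge0 : 0 <= opnorm f.
Proof. by rewrite (le_trans _ (@opnorm_ub 0 _)) ?normr0. Qed.

Lemma le_opnorm x : `|f x| <= opnorm f * `|x|.
Proof.
have [->|x0] := eqVneq x 0; first by rewrite linear0 !normr0 mulr0.
have nx : 0 < `|x| by rewrite normr_gt0.
rewrite -ler_pdivrMr// mulrC -[X in X * _]ger0_norm ?invr_ge0//.
rewrite -normrZ -linearZ; apply: opnorm_ub.
by rewrite normrZ ger0_norm ?invr_ge0// mulVf// gt_eqF.
Qed.

End opnorm.

Lemma le_bounded_op (R : realType) (V W : normedModType R) (f : {linear V -> W}) M :
  (forall x, `|f x| <= M * `|x|) -> bounded_op f.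
Proof. by exists M. Qed.

Lemma opnormM_le (R : realType) (U V W Y : normedModType R) (f : {linear U -> V})
    (g : {linear W -> Y}) M :
  0 <= M -> (forall x, `|f x| <= 1 * `|x|) -> (forall x, `|g x| <= M * `|x|) ->
  opnorm f * opnorm g <= M.
Proof.
move=> M0 fM gM; rewrite -[leRHS]mul1r.
rewrite ler_pM ?opnorm_ge0 ?opnorm_le//; first exact: le_bounded_op fM.
exact: le_bounded_op gM.
Qed.

(** The norm of [A] is shifted to [B]: gluing infinitely many first factors requires a common bound
    on their norms. *)
Lemma normalized_factors (R : realType) (Z V W Y : normedModType R)
    (A : {linear Z -> V}) (B : {linear W -> Y}) (j : V -> W) (T : {linear Z -> Y}) :
  bounded_op A -> bounded_op B -> (forall z, T z = B (j (A z))) ->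
  exists (A' : {linear Z -> V}) (B' : {linear W -> Y}),
    [/\ forall z, `|A' z| <= `|z|,
        forall w, `|B' w| <= opnorm A * opnorm B * `|w| &
        forall z, T z = B' (j (A' z))].
Proof.
move=> bA bB TE; pose c := opnorm A; have c0 : 0 <= c by exact: opnorm_ge0.
exists (c^-1 \*: A), (c \*: B); split=> [z|w|z] /=.
- rewrite normrZ ger0_norm ?invr_ge0//.
  have [->|cn0] := eqVneq c 0; first by rewrite invr0 mul0r.
  by rewrite ler_pdivrMl ?lt0r ?cn0//; exact: le_opnorm.
- by rewrite normrZ ger0_norm// -mulrA ler_wpM2l// le_opnorm.
(* As [j] is an arbitrary map, the scalar is moved inside [A] and taken out again by linearity of
   [T]. *)
- rewrite -[X in j X]linearZ -TE; have [cE|cn0] := eqVneq c 0; last first.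
    by rewrite linearZ/= scalerA divff// scale1r.
  (* The junk value 0^-1 = 0 is harmless: if A = 0, then T z = B (j 0) = T 0 = 0. *)
  have A0 x : A x = 0.
    by apply/eqP; rewrite -normr_le0 (le_trans (le_opnorm bA x))// -/c cE mul0r.
  by rewrite cE scale0r TE A0 -(linear0 A) -TE linear0.
Qed.

(** * Operators into the direct sum and into [L_oo] of the union *)

Section dsum_operator.
Context (R : realType) (E : completeNormedModType R) (e : nat -> E).
Context (he : normalized_unconditional1_basis e).
Context (X : nat -> completeNormedModType R).

(** By unconditionality, a convergent majorant [u w] of the coordinate norms gives both membership
    in the direct sum and the norm bound. *)
Lemma dsum_operator (W : normedModType R) (T : forall n, {linear W -> X n})
    (u : W -> nat -> R) (C : R) :
  (forall w n, `|T n w| <= u w n) ->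
  (forall w, cvgn (series (fun n => u w n *: e n))) ->
  (forall w, `|limn (series (fun n => u w n *: e n))| <= C * `|w|) ->
  exists B : {linear W -> dsum he X},
    (forall w n, B w n = T n w) /\ forall w, `|B w| <= C * `|w|.
Proof.
move=> Tu uc uC.
have Tu' w n : `| `|T n w| | <= `|u w n|.
  by rewrite normr_id; exact: le_trans (Tu w n) (ler_norm _).
have Tc w : cvgn (series (fun n => `|T n w| *: e n)).
  exact: (unconditional_cvg he (Tu' w) (uc w)).
pose Bf w : dsum he X := DSum he (Tc w).
have Bl : linear Bf by move=> a x y; apply: dsumP => n; exact: linearP.
pose B : {linear W -> dsum he X} := HB.pack Bf (GRing.isLinear.Build _ _ _ _ Bf Bl).
exists B; split=> // w; apply: le_trans (uC w).
exact: (unconditional_lim_le he (Tu' w) (uc w)).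
Qed.

End dsum_operator.

Section infty_operator.
Context (d : nat -> measure_display) (Om : forall n, measurableType (d n)).
Context (R : realType) (mu : forall n, {measure set Om n -> \bar R}).
Context (lam : nat -> R) (lam0 : forall n, 0 < lam n).
Local Notation nu := (sum_measure mu lam0).

Lemma infty_operator (Z : normedModType R)
    (A_ : forall n, {linear Z -> LspaceType (mu n) (leey 1%E)}) :
  (forall n z, `|A_ n z| <= `|z|) ->
  exists A : {linear Z -> LspaceType nu (leey 1%E)},
    (forall n z, restriction n (A z) = A_ n z) /\ forall z, `|A z| <= `|z|.
Proof.
move=> A1.
have G z := glue_infty lam0 (normr_ge0 z) (fun n => A1 n z).
have [Af AfP] := choice G.
have Al : linear Af.
  move=> a x y; apply: restriction_inj => n.
  rewrite [RHS]linearP /=.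
  by rewrite (AfP (a *: x + y)).1 (AfP x).1 (AfP y).1 linearP.
pose A : {linear Z -> LspaceType nu (leey 1%E)} :=
  HB.pack Af (GRing.isLinear.Build _ _ _ _ Af Al).
by exists A; split=> [n z|z]; [exact: (AfP z).1|exact: (AfP z).2].
Qed.

End infty_operator.

(** A record in [Type] rather than an existential, so that the spaces, measures and operators chosen
    for all [n] form families. The first factor is normalized and [b] bounds the second. *)
Record finite_factorization (R : realType) (q : \bar R) (q1 : (1 <= q)%E)
    (Z Y : normedModType R) (T : Z -> Y) (b : R) : Type := FiniteFactorization {
  ff_disp : measure_display ;
  ff_space : measurableType ff_disp ;
  ff_mu : probability ff_space R ;
  ff_A : {linear Z -> LspaceType ff_mu (leey 1%E)} ;
  ff_B : {linear LspaceType ff_mu q1 -> Y} ;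
  ff_normA : forall z, `|ff_A z| <= `|z| ;
  ff_normB : forall f, `|ff_B f| <= b * `|f| ;
  ff_eq : forall z, T z = ff_B (Linfty_incl q1 (ff_A z)) }.

Record infinite_factorization (R : realType)
    (Z Y : normedModType R) (T : Z -> Y) (b : R) : Type := InfiniteFactorization {
  if_disp : measure_display ;
  if_space : measurableType if_disp ;
  if_mu : {measure set if_space -> \bar R} ;
  if_A : {linear Z -> LspaceType if_mu (leey 1%E)} ;
  if_B : {linear LspaceType if_mu (leey 1%E) -> Y} ;
  if_normA : forall z, `|if_A z| <= `|z| ;
  if_normB : forall f, `|if_B f| <= b * `|f| ;
  if_eq : forall z, T z = if_B (if_A z) }.

Section costs.
Context (R : realType) (q : \bar R) (q1 : (1 <= q)%E) (Z Y : normedModType R).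

Lemma integral_costs_ge0 (T : Z -> Y) c : integral_costs q1 T c -> 0 <= c.
Proof.
by rewrite /integral_costs; case: ifP => _ [d [Om [mu [A [B [bA bB _ ->]]]]]];
  rewrite mulr_ge0// opnorm_ge0.
Qed.

Lemma i_q_ge0 (T : Z -> Y) : q_integral q1 T -> 0 <= i_q q1 T.
Proof. by move=> T0; apply: lb_le_inf => // c; exact: integral_costs_ge0. Qed.

Lemma i_q_le (T : Z -> Y) c : integral_costs q1 T c -> i_q q1 T <= c.
Proof. by apply: ge_inf; exists 0 => ?; exact: integral_costs_ge0. Qed.

Lemma i_q_lt (T : Z -> Y) b : q_integral q1 T -> i_q q1 T < b ->
  exists2 c, integral_costs q1 T c & c < b.
Proof.
by move=> T0; exact: inf_lt.
Qed.

Lemma finite_factorization_lt (T : {linear Z -> Y}) b : q != +oo%E ->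
  q_integral q1 T -> i_q q1 T < b -> $| finite_factorization q1 T b |.
Proof.
move=> qy T0 /(i_q_lt T0)[c]; rewrite /integral_costs (negbTE qy).
move=> [d [Om [mu [A [B [bA bB TE ->]]]]]] /ltW cb.
have [A' [B' [A1 B1 TE']]] := normalized_factors bA bB TE.
apply: squash; exists d Om mu A' B' => // f.
by rewrite (le_trans (B1 f))// ler_wpM2r.
Qed.

Lemma infinite_factorization_lt (T : {linear Z -> Y}) b : q == +oo%E ->
  q_integral q1 T -> i_q q1 T < b -> $| infinite_factorization T b |.
Proof.
move=> qy T0 /(i_q_lt T0)[c]; rewrite /integral_costs qy.
move=> [d [Om [mu [A [B [bA bB TE ->]]]]]] /ltW cb.
have [A' [B' [A1 B1 TE']]] := normalized_factors (j := id) bA bB TE.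
apply: squash; exists d Om mu A' B' => // f.
by rewrite (le_trans (B1 f))// ler_wpM2r.
Qed.

End costs.

(** * Gluing the factorizations of the coordinates *)

Section assembly.
Context (R : realType) (E : completeNormedModType R) (e : nat -> E).
Context (he : normalized_unconditional1_basis e).
Context (X : nat -> completeNormedModType R) (Z : completeNormedModType R).
Context (S : {linear Z -> dsum he X}) (b : nat -> R) (C : R).
Hypothesis C0 : 0 <= C.

(** Restriction does not increase the [L_oo] norm, so the coordinates of [B w] are dominated by
    [|w| * b n], and [B] has norm at most [C]. *)
Lemma infinite_integral_dsum :
  (forall n, 0 <= b n) -> cvgn (series (fun n => b n *: e n)) ->
  `|limn (series (fun n => b n *: e n))| <= C ->
  (forall n, infinite_factorization (dsum_proj n \o S) (b n)) ->
  exists2 c, infinite_integral_costs S c & c <= C.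
Proof.
move=> b0 bc bC F.
pose mu n := if_mu (F n).
pose lam0 (n : nat) : 0 < (1 : R) := ltr01.
have [A [AE A1]] := infty_operator lam0 (fun n => if_normA (F n)).
have A1' z : `|A z| <= 1 * `|z| by rewrite mul1r.
pose L := LspaceType (sum_measure mu lam0) (leey 1%E).
pose r n : {linear L -> LspaceType (mu n) (leey 1%E)} :=
  @restriction _ _ _ mu _ lam0 _ (leey 1%E) n.
have uc (w : L) := coef_seriesZ (c := `|w|) bc.
have [|||B [BE BC]] := @dsum_operator R E e he X L (fun n => if_B (F n) \o r n)
    (fun w n => `|w| * b n) C.
- move=> w n /=.
  apply: (le_trans (if_normB _)).
  by rewrite mulrC ler_wpM2r// restriction_infty_norm.
- by move=> w; exact: cvgP (uc w).
- move=> w; rewrite (cvg_lim (@norm_hausdorff _ _) (uc w)) normrZ normr_id mulrC.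
  by rewrite ler_wpM2r.
exists (opnorm A * opnorm B); last exact: opnormM_le C0 A1' BC.
exists _, _, (sum_measure mu lam0), A, B; split => //.
- exact: le_bounded_op A1'.
- exact: le_bounded_op BC.
- move=> z; apply: dsumP => n.
  by rewrite BE /= /r AE -(if_eq (F n)).
Qed.

(** The coordinates of [B w] are dominated by [b n * |rn n w|]; [dominated_coef_cvg] applies with
    [M = |w|] because [\sum_n lam n * |rn n w| ^ r] is at most [|w| ^ r]. *)
Lemma finite_integral_dsum (r : R) (r1 : (1 <= r%:E)%E) (lam : nat -> R) :
  (forall n, 0 < lam n) -> (\sum_(n <oo) (lam n)%:E = 1)%E ->
  (forall N (s : nat -> R), `|\sum_(n < N) s n *: (b n *: e n)| `^ r <=
    C `^ r * \sum_(n < N) lam n * `|s n| `^ r) ->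
  (forall n, finite_factorization r1 (dsum_proj n \o S) (b n)) ->
  exists2 c, finite_integral_costs r1 S c & c <= C.
Proof.
move=> lam0 lam1 dom F.
pose P n := ff_mu (F n).
pose mu n : {measure set (ff_space (F n)) -> \bar R} := P n.
have [A [AE A1]] := infty_operator (mu := mu) lam0 (fun n => ff_normA (F n)).
have A1' z : `|A z| <= 1 * `|z| by rewrite mul1r.
pose L := LspaceType (sum_measure mu lam0) r1.
pose rn n : {linear L -> LspaceType (mu n) r1} :=
  @restriction _ _ _ mu _ lam0 _ r1 n.
have uc (w : L) := @dominated_coef_cvg R E e r C `|w| b lam
  (fun n => `|rn n w|) r1 C0 (normr_ge0 w) (fun n => ltW (lam0 n)) dom.
have rw (w : L) N : \sum_(n < N) lam n * `| `|rn n w| | `^ r <= `|w| `^ r.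
  by under eq_bigr do rewrite normr_id; exact: restriction_norm_sum.
have [|||B [BE BC]] := @dsum_operator R E e he X L (fun n => ff_B (F n) \o rn n)
    (fun w n => b n * `|rn n w|) C.
- by move=> w n /=; exact: ff_normB.
- by move=> w; have [] := uc w (rw w).
- by move=> w; have [] := uc w (rw w).
exists (opnorm A * opnorm B); last exact: opnormM_le C0 A1' BC.
exists _, _, (sum_probability P lam0 lam1), A, B; split => //.
- exact: le_bounded_op A1'.
- exact: le_bounded_op BC.
- move=> z; apply: dsumP => n.
  (* In coordinate [n], restriction commutes with the formal inclusion and undoes the gluing, which
     leaves the factorization [F n]. *)
  by rewrite BE /= /rn restriction_incl AE -(ff_eq (F n)).
Qed.

End assembly.

Lemma integral_dsum (R : realType) (E : completeNormedModType R) (e : nat -> E)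
    (he : normalized_unconditional1_basis e)
    (X : nat -> completeNormedModType R) (Z : completeNormedModType R)
    (q : \bar R) (q1 : (1 <= q)%E) (S : {linear Z -> dsum he X}) (K C : R)
    (b : nat -> R) :
  q_concave_with he q K -> (forall n, 0 < b n) ->
  cvgn (series (fun n => b n *: e n)) ->
  K * `|limn (series (fun n => b n *: e n))| < C ->
  (forall n, q_integral q1 (dsum_proj n \o S)) ->
  (forall n, i_q q1 (dsum_proj n \o S) < b n) ->
  exists2 c, integral_costs q1 S c & c <= C.
Proof.
move=> Kc b0 bc KbC iS ib.
have K1 := q_concave_with_ge1 q1 Kc.
have C0 : 0 <= C.
  by rewrite (le_trans _ (ltW KbC))// mulr_ge0// (le_trans ler01).
have [qy|qy] := boolP (q == +oo%E).
  rewrite /integral_costs qy.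
  have F n := unsquash (infinite_factorization_lt qy (iS n) (ib n)).
  apply: (infinite_integral_dsum C0 _ bc _ F) => [n|]; first exact: ltW.
  (* Here [1 <= K] removes the factor [K] from [KbC]. *)
  by rewrite (le_trans _ (ltW KbC))// ler_peMl.
have F n := unsquash (finite_factorization_lt qy (iS n) (ib n)).
rewrite /integral_costs (negbTE qy).
move: q q1 Kc F qy {iS ib} => [r||]//= r1 Kc F _.
have [lam [lam0 lam1 dom]] := probability_domination r1 Kc b0 bc KbC.
exact: (finite_integral_dsum C0 lam0 lam1 dom F).
Qed.

Theorem corollary1p5 (R : realType) (E : completeNormedModType R) (e : nat -> E)
    (he : normalized_unconditional1_basis e)
    (X : nat -> completeNormedModType R) (Z : completeNormedModType R)
    (q : \bar R) (q1 : (1 <= q)%E) (hq : q_concave he q)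
    (S : {linear Z -> dsum he X}) (hS : bounded_op S)
    (hPS : forall n, q_integral q1 (dsum_proj n \o S))
    (hcvg : cvgn (series (fun n => i_q q1 (dsum_proj n \o S) *: e n))) :
  q_integral q1 S /\
  i_q q1 S <= concavity_constant he q *
    `|limn (series (fun n => i_q q1 (dsum_proj n \o S) *: e n))|.
Proof.
have [Kc _] := concavity_constantP q1 hq.
set K := concavity_constant he q in Kc *.
have K1 : 1 <= K by exact: q_concave_with_ge1 q1 Kc.
have K0 : 0 < K by rewrite (lt_le_trans ltr01).
set a := fun n => i_q q1 (dsum_proj n \o S) in hcvg *.
set V := `|limn _|.
have a0 n : 0 <= a n by exact: i_q_ge0.
(* Costs are produced only up to a bound strictly above [K * V]; the infimum then gives the sharp
   inequality. *)
suff H C : K * V < C -> exists2 c, integral_costs q1 S c & c <= C.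
  have H1 C : K * V < C -> i_q q1 S <= C.
    by move=> /H[c Sc]; exact: le_trans (i_q_le Sc).
  split; last by apply/ler_addgt0Pr => eps eps0; apply: H1; rewrite ltrDl.
  by have [|c Sc _] := H (K * V + 1); [rewrite ltrDl|exists c].
(* With this choice [K * (V + eps)] is the midpoint of [K * V] and [C]. *)
move=> VC; pose eps := (C - K * V) / (2 * K).
have eps0 : 0 < eps by rewrite divr_gt0 ?subr_gt0 ?mulr_gt0.
have [b [ab bc bV]] := perturbed_coef he eps0 a0 hcvg.
have b0 n : 0 < b n by exact: le_lt_trans (a0 n) (ab n).
have KbC : K * `|limn (series (fun n => b n *: e n))| < C.
  apply: le_lt_trans (ler_wpM2l (ltW K0) bV) _.
  have -> : K * (V + eps) = (C + K * V) / 2.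
    by rewrite /eps; field; rewrite gt_eqF.
  by lra.
exact: (integral_dsum Kc b0 bc KbC hPS ab).
Qed.
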